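(* Let $m,k$ be real constants with $k\geq m\geq 2$, and let $\gamma_1,\gamma_2,\gamma_3>0$ be real numbers such that either $$2\big(\gamma_1-\gamma_2-m^2\gamma_3-3m(k-1)\gamma_3-e(e+1)\big)\geq \pi e$$ or $$2\Big(1-e-e\big(\gamma_1+\gamma_2+m^2\gamma_3+3m(k-1)\gamma_3\big)\Big)\geq \pi.$$ If $p$ is an analytic function in $\mathbb{D}$ such that $p(0)=1$ and $$p(z)+\gamma_1 zp'(z)+\gamma_2 z^2p''(z)+\gamma_3 z^3p'''(z)\prec 1+\sinh^{-1} z,$$ then $p(z)\prec e^z$.
   Context: $\mathbb{D}=\{z\in\mathbb{C}:|z|<1\}$ is the open unit disk. Here $\sinh^{-1}$ is the principal branch of the inverse hyperbolic sine, $\sinh^{-1}z=\log(z+\sqrt{1+z^2})$, analytic on $\mathbb{D}$ with value $0$ at $z=0$. For analytic functions $g,h$ on $\mathbb{D}$, $g\prec h$ ($g$ is subordinate to $h$) means that there is an analytic function $w:\mathbb{D}\to\mathbb{D}$ with $w(0)=0$ and $|w(z)|\le|z|$ such that $g(z)=h(w(z))$ for all $z\in\mathbb{D}$. *)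

(* Defs.v *)
(* Classical reals of the standard library with Coquelicot's complex numbers. *)
From Stdlib Require Export Reals.
From Coquelicot Require Export Coquelicot.

Open Scope R_scope.

(* Membership in the open unit disk. *)
Definition in_disk (z : C) : Prop := Cmod z < 1.

(* Analyticity as complex differentiability at every point of the (open) disk.
   Functions are total on [C]; their values off the disk play no role. *)
Definition analytic_on_disk (f : C -> C) : Prop :=
  forall z : C, in_disk z -> ex_derive (K := C_AbsRing) (V := C_NormedModule) f z.

(* e^(x + iy) = e^x (cos y + i sin y) *)
Definition Cexp (z : C) : C :=
  (RtoC (exp (Re z)) * (cos (Im z), sin (Im z)))%C.

(* Principal argument, in (-PI, PI], for z <> 0; its value at 0 is irrelevant. *)
Definition Carg (z : C) : R :=
  if Rle_dec 0 (Im z) then acos (Re z / Cmod z) else - acos (Re z / Cmod z).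

(* Principal logarithm, for z <> 0. *)
Definition Clog (z : C) : C := (ln (Cmod z), Carg z).

(* Principal square root: |z|^(1/2) e^(i Arg(z) / 2), which is 0 at z = 0. *)
Definition Csqrt (z : C) : C :=
  (RtoC (sqrt (Cmod z)) * Cexp (Ci * RtoC (Carg z / 2)))%C.

(* On the disk 1 + z^2 lies in the right half-plane, so this is a composition
   of principal branches away from the cut of [Csqrt]. *)
Definition Carcsinh (z : C) : C := Clog (z + Csqrt (1 + z * z))%C.

(* [g] and [h] are meant to be analytic on the disk. *)
Definition subordinate (g h : C -> C) : Prop :=
  exists w : C -> C,
    analytic_on_disk w /\
    (forall z : C, in_disk z -> in_disk (w z)) /\
    w (RtoC 0) = RtoC 0 /\
    (forall z : C, in_disk z -> Cmod (w z) <= Cmod z) /\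
    (forall z : C, in_disk z -> g z = h (w z)).

(* Main.v *)
Require Import Defs.
From Stdlib Require Import Reals.
From Coquelicot Require Import Coquelicot.
From Stdlib Require Import Lra Lia Psatz ClassicalEpsilon.
Open Scope R_scope.

(** The operator [L p = p + g1 z p' + g2 z^2 p'' + g3 z^3 p'''] acts diagonally on
    power series: it multiplies the n-th coefficient by
    [1 + g1 n + g2 n (n - 1) + g3 n (n - 1) (n - 2)], which is at least [g1 n].
    The condition on the constants forces [g1 >= 14], so [p] is much closer to its
    constant term 1 than [L p] is, and the theorem follows from size estimates
    alone.

    Quantitatively, [L p - 1] is a value of the inverse hyperbolic sine on the disk,
    hence bounded by [M = 3.6] ([Carcsinh_bound]).  Bessel's inequality on a circle
    of radius [rho] close to 1 ([bessel_bound]) turns this bound into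
    [sum |b_n|^2 rho^(2n) <= M^2] for the coefficients [b_n] of [L p - 1].  Since
    the coefficients of [p - 1] are at most [|b_n| / (g1 n)] and [sum 1/n^2 <= 2],
    the arithmetic-geometric mean inequality gives
    [|p(z) - 1| <= 3 M / (2 g1) |z| / rho <= 0.41 |z|] ([deviation_bound]).
    Thus [p] takes values in the right half-plane, [w = log p] is analytic, and
    [|w(z)| <= |z|] because [|log q| <= sqrt 2 u / (1 - u)] when [|q - 1| = u]
    ([right_log_bound]).  This [w] is the required Schwarz function.

    Analyticity means complex differentiability at each point, so power series
    have to be earned.  Goursat's argument is run for a closed form
    [A dt + B dtheta] on a rectangle ([goursat], by repeated bisection), and applied
    to [f(z) dz / (z - z0)] pulled back along the homotopy that shrinks a circle
    to the point [z0].  This yields Cauchy's formula ([cauchy_kernel]), and expanding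
    its kernel as a geometric series yields the Taylor series ([taylor_expansion]). *)

(** * Moduli of complex numbers *)

(** The derived goals are equations in a carrier such as
    [NormedModule.sort C_AbsRing C_NormedModule], which [ring] does not recognise as [C]. *)
Ltac Cring := match goal with |- @eq _ ?a ?b => change (@eq C a b) end; ring.

Lemma Cmod_minus_triangle (x y : C) : Cmod (x - y) <= Cmod x + Cmod y.
Proof.
  unfold Cminus. rewrite <- (Cmod_opp y). apply Cmod_triangle.
Qed.

Lemma Cmod_le_Rabs (z : C) : Cmod z <= Rabs (fst z) + Rabs (snd z).
Proof.
  pose proof (Rabs_pos (fst z)) as A. pose proof (Rabs_pos (snd z)) as B.
  apply Rsqr_incr_0_var; [|lra]. unfold Rsqr, Cmod. rewrite sqrt_sqrt.
  - rewrite <- (pow2_abs (fst z)), <- (pow2_abs (snd z)). nra.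
  - apply Rplus_le_le_0_compat; apply pow2_ge_0.
Qed.

Lemma Rabs_Re_Im_le (h : C) : Rabs (Re h) <= Cmod h /\ Rabs (Im h) <= Cmod h.
Proof.
  pose proof (Rmax_Cmod h) as H. split; eapply Rle_trans; [apply Rmax_l|exact H|apply Rmax_r|exact H].
Qed.

Lemma Cmod_le_squares (x y B : R) : 0 <= B -> x ^ 2 + y ^ 2 <= B ^ 2 -> Cmod (x, y) <= B.
Proof.
  intros HB H. unfold Cmod. simpl fst. simpl snd. rewrite <- (sqrt_pow2 B) by exact HB.
  now apply sqrt_le_1_alt.
Qed.

Lemma RtoC_neq_0 (x : R) : x <> 0 -> RtoC x <> 0%C.
Proof. intros H E. apply H. now apply RtoC_inj. Qed.

(** Chooses the tolerance [eta] with which a bound [eta * K] falls below [eps]. *)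
Lemma small_multiple (eps K : R) : 0 < eps -> 0 <= K ->
  exists eta, 0 < eta <= 1 /\ eta * K <= eps.
Proof.
  intros He HK. exists (Rmin 1 (eps / (K + 1))).
  assert (0 < eps / (K + 1)) by (apply Rdiv_lt_0_compat; lra).
  split; [split; [apply Rmin_pos; lra | apply Rmin_l]|].
  apply Rle_trans with (eps / (K + 1) * K).
  - apply Rmult_le_compat_r; [exact HK | apply Rmin_r].
  - assert (eps / (K + 1) * (K + 1) = eps) by (field; lra). nra.
Qed.

Lemma Cmod_le_eps_0 (z : C) (K : R) :
  0 <= K -> (forall eps, 0 < eps -> Cmod z <= eps * K) -> z = 0%C.
Proof.
  intros HK H. apply Cmod_eq_0. apply Rle_antisym; [|apply Cmod_ge_0].
  apply Rnot_lt_le. intros Hpos.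
  specialize (H (Cmod z / (2 * (K + 1)))).
  assert (0 < Cmod z / (2 * (K + 1))) as Hp by (apply Rdiv_lt_0_compat; lra).
  specialize (H Hp).
  assert (Cmod z / (2 * (K + 1)) * (2 * (K + 1)) = Cmod z) as E by (field; lra).
  nra.
Qed.

Lemma one_minus_bound (q : C) (rho : R) : Cmod q <= rho -> rho < 1 ->
  (1 - q)%C <> 0%C /\ Cmod (/ (1 - q)) <= / (1 - rho).
Proof.
  intros Hq Hr.
  assert (H : 1 - rho <= Cmod (1 - q)).
  { pose proof (Cmod_triangle (1 - q) q) as T.
    replace (1 - q + q)%C with (RtoC 1) in T by ring. rewrite Cmod_1 in T. lra. }
  assert (H0 : (1 - q)%C <> 0%C) by (apply Cmod_gt_0; lra).
  split; [exact H0|]. rewrite Cmod_inv by exact H0.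
  apply Rinv_le_contravar; lra.
Qed.

(** * Limits, derivatives and series in terms of the modulus *)

Notation RCcontinuous := (continuous (T := R_UniformSpace) (U := C_R_CompleteNormedModule)).
Notation is_CRInt := (is_RInt (V := C_R_NormedModule)).
Notation is_Cseries := (is_series (K := C_AbsRing) (V := C_NormedModule)).
Notation is_Cderive := (is_derive (K := C_AbsRing) (V := C_NormedModule)).
Notation ex_Cderive := (ex_derive (K := C_AbsRing) (V := C_NormedModule)).

(** Only a propositional equality: as a real normed space, [C] carries the product
    norm, in which the coordinates appear through their absolute values. *)
Lemma norm_C_R (z : C) : norm (K := R_AbsRing) (V := C_R_NormedModule) z = Cmod z.
Proof. symmetry. apply Cmod_norm. Qed.

Lemma C_derive_eps (f : C -> C) (z l : C) :
  is_Cderive f z l <->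
  (forall eps, 0 < eps -> exists delta, 0 < delta /\
     forall y : C, Cmod (y - z) < delta ->
       Cmod (f y - f z - (y - z) * l) <= eps * Cmod (y - z)).
Proof.
  split.
  - intros [_ H] eps Heps.
    destruct (H z (fun P H => H) (mkposreal eps Heps)) as [d Hd].
    exists d. split. apply cond_pos.
    intros y Hy. exact (Hd y Hy).
  - intros H. split. apply (is_linear_scal_l (K := C_AbsRing) (V := C_NormedModule) l).
    intros x Hx.
    assert (z = x) as <- by (apply (is_filter_lim_locally_unique (K:=C_AbsRing) (V := AbsRing_NormedModule C_AbsRing)); exact Hx).
    intros [eps Heps].
    destruct (H eps Heps) as [d [Hd0 Hd]].
    exists (mkposreal d Hd0). intros y Hy. exact (Hd y Hy).
Qed.

Lemma C_derive_continuous (f : C -> C) (z : C) :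
  ex_Cderive f z ->
  forall eps, 0 < eps -> exists delta, 0 < delta /\
    forall y, Cmod (y - z) < delta -> Cmod (f y - f z) < eps.
Proof.
  intros [l Hl] eps Heps.
  destruct (proj1 (C_derive_eps f z l) Hl 1 Rlt_0_1) as [d [P H]].
  set (M := 1 + Cmod l). pose proof (Cmod_ge_0 l) as H0.
  assert (HM : 0 < M) by (unfold M; lra).
  exists (Rmin d (eps / M)). split.
  { apply Rmin_pos; [exact P|]. apply Rdiv_lt_0_compat; lra. }
  intros y Hy. pose proof (Rlt_le_trans _ _ _ Hy (Rmin_r _ _)) as Hb.
  specialize (H y (Rlt_le_trans _ _ _ Hy (Rmin_l _ _))).
  replace (f y - f z)%C with ((f y - f z - (y - z) * l) + (y - z) * l)%C by ring.
  eapply Rle_lt_trans. apply Cmod_triangle. rewrite Cmod_mult.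
  apply Rle_lt_trans with (Cmod (y - z) * M); [unfold M; lra|].
  apply (Rmult_lt_compat_r M) in Hb; [|lra]. unfold Rdiv in Hb.
  rewrite Rmult_assoc, Rinv_l in Hb by lra. lra.
Qed.

Lemma R_derive_eps (f : R -> R) (x l : R) :
  is_derive f x l -> forall eps, 0 < eps -> exists delta, 0 < delta /\
    forall y, Rabs (y - x) < delta -> Rabs (f y - f x - (y - x) * l) <= eps * Rabs (y - x).
Proof.
  intros H eps Heps. destruct H as [_ H].
  destruct (H x (fun P H => H) (mkposreal eps Heps)) as [d Hd].
  exists d. split. apply cond_pos. intros y Hy. exact (Hd y Hy).
Qed.

Lemma RC_continuous_eps (f : R -> C) (x : R) :
  RCcontinuous f x <->
  (forall eps, 0 < eps -> exists delta, 0 < delta /\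
     forall y : R, Rabs (y - x) < delta -> Cmod (f y - f x) < eps).
Proof.
  split.
  - intros H eps Heps.
    destruct (proj1 (filterlim_locally_ball_norm (U := C_R_NormedModule) (F := locally x) f (f x)) H (mkposreal eps Heps)) as [d Hd].
    exists d. split. apply cond_pos.
    intros y Hy. rewrite <- norm_C_R. exact (Hd y Hy).
  - intros H. apply (filterlim_locally_ball_norm (U := C_R_NormedModule)).
    intros [eps Heps]. destruct (H eps Heps) as [d [Hd0 Hd]].
    exists (mkposreal d Hd0). intros y Hy. hnf. rewrite norm_C_R. exact (Hd y Hy).
Qed.

Lemma C_continuous_eps (g : C -> R) (a : C) :
  continuous (T := C_UniformSpace) (U := R_UniformSpace) g a ->
  forall eps, 0 < eps -> exists delta, 0 < delta /\
    forall b, Cmod (b - a) < delta -> Rabs (g b - g a) < eps.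
Proof.
  intros H eps Heps.
  destruct (proj1 (filterlim_locally g (g a)) H (mkposreal eps Heps)) as [d Hd].
  exists d. split; [apply cond_pos|]. intros b Hb. apply Hd.
  destruct (Rabs_Re_Im_le (b - a)) as [R1 R2].
  split.
  - change (Rabs (Re (b - a)) < d). lra.
  - change (Rabs (Im (b - a)) < d). lra.
Qed.

Lemma C_series_eps (a : nat -> C) (l : C) :
  is_Cseries a l <->
  (forall eps, 0 < eps -> exists N, forall n, (N <= n)%nat ->
     Cmod (sum_n a n - l) < eps).
Proof.
  split.
  - intros H eps Heps.
    destruct (proj1 (filterlim_locally_ball_norm (U := C_NormedModule) (F := eventually) (sum_n a) l) H (mkposreal eps Heps)) as [N HN].
    exists N. intros n Hn. exact (HN n Hn).
  - intros H. apply (filterlim_locally_ball_norm (U := C_NormedModule)).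
    intros [eps Heps]. destruct (H eps Heps) as [N HN].
    exists N. intros n Hn. exact (HN n Hn).
Qed.

Lemma RC_continuous_const (c : C) (x : R) : RCcontinuous (fun _ => c) x.
Proof. apply continuous_const. Qed.

Lemma RC_continuous_plus (f g : R -> C) x :
  RCcontinuous f x -> RCcontinuous g x -> RCcontinuous (fun t => (f t + g t)%C) x.
Proof. intros. now apply (continuous_plus (V := C_R_NormedModule)). Qed.

Lemma RC_continuous_minus (f g : R -> C) x :
  RCcontinuous f x -> RCcontinuous g x -> RCcontinuous (fun t => (f t - g t)%C) x.
Proof. intros. now apply (continuous_minus (V := C_R_NormedModule)). Qed.

Lemma RC_continuous_mult (f g : R -> C) x :
  RCcontinuous f x -> RCcontinuous g x -> RCcontinuous (fun t => (f t * g t)%C) x.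
Proof.
  intros Hf Hg. apply RC_continuous_eps. intros eps Heps.
  set (M := Cmod (f x) + Cmod (g x) + 1).
  pose proof (Cmod_ge_0 (f x)) as Pf. pose proof (Cmod_ge_0 (g x)) as Pg.
  assert (HM : 0 < M) by (unfold M; lra).
  set (e := Rmin 1 (eps / (2 * M))).
  assert (He : 0 < e) by (apply Rmin_pos; [lra | apply Rdiv_lt_0_compat; lra]).
  assert (He1 : e <= 1) by apply Rmin_l.
  assert (He2 : e * M <= eps / 2).
  { replace (eps / 2) with (eps / (2 * M) * M) by (field; lra).
    apply Rmult_le_compat_r; [lra | apply Rmin_r]. }
  destruct (proj1 (RC_continuous_eps f x) Hf e He) as [d1 [P1 H1]].
  destruct (proj1 (RC_continuous_eps g x) Hg e He) as [d2 [P2 H2]].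
  exists (Rmin d1 d2). split. now apply Rmin_pos. intros y Hy.
  specialize (H1 y (Rlt_le_trans _ _ _ Hy (Rmin_l _ _))).
  specialize (H2 y (Rlt_le_trans _ _ _ Hy (Rmin_r _ _))).
  replace (f y * g y - f x * g x)%C with
    ((f y - f x) * (g y - g x) + ((f y - f x) * g x + f x * (g y - g x)))%C by ring.
  eapply Rle_lt_trans. apply Cmod_triangle.
  eapply Rle_lt_trans. apply Rplus_le_compat_l, Cmod_triangle.
  rewrite !Cmod_mult.
  pose proof (Cmod_ge_0 (f y - f x)). pose proof (Cmod_ge_0 (g y - g x)).
  unfold M in *. nra.
Qed.

Lemma RC_continuous_inv (f : R -> C) x :
  RCcontinuous f x -> f x <> 0%C -> RCcontinuous (fun t => (/ f t)%C) x.
Proof.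
  intros Hf H0. apply RC_continuous_eps. intros eps Heps.
  set (m := Cmod (f x)). assert (Hm : 0 < m) by now apply Cmod_gt_0.
  destruct (proj1 (RC_continuous_eps f x) Hf (Rmin (m / 2) (eps * m ^ 2 / 2))) as [d [P H]].
  { apply Rmin_pos; [lra|]. apply Rdiv_lt_0_compat; [|lra]. apply Rmult_lt_0_compat; [lra|]. now apply pow_lt. }
  exists d. split; [exact P|]. intros y Hy. specialize (H y Hy).
  pose proof (Rlt_le_trans _ _ _ H (Rmin_l _ _)) as Ha.
  pose proof (Rlt_le_trans _ _ _ H (Rmin_r _ _)) as Hb.
  assert (Hfy : m / 2 < Cmod (f y)).
  { pose proof (Cmod_triangle (f y) (- (f y - f x))%C) as T.
    replace (f y + - (f y - f x))%C with (f x) in T by ring.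
    rewrite Cmod_opp in T. fold m in T. lra. }
  assert (f y <> 0%C) by (apply Cmod_gt_0; lra).
  replace (/ f y - / f x)%C with (- ((f y - f x) * / (f y * f x)))%C by (field; auto).
  rewrite Cmod_opp, Cmod_mult, Cmod_inv by (now apply Cmult_neq_0).
  rewrite Cmod_mult. fold m.
  assert (0 < Cmod (f y) * m) by nra.
  apply (Rmult_lt_reg_r (Cmod (f y) * m)); [assumption|].
  rewrite Rmult_assoc, Rinv_l, Rmult_1_r by lra.
  eapply Rlt_trans. exact Hb.
  assert (eps * m * (m / 2) < eps * m * Cmod (f y)) as A
    by (apply Rmult_lt_compat_l; [now apply Rmult_lt_0_compat | exact Hfy]).
  lra.
Qed.

Lemma RC_continuous_pow (f : R -> C) (x : R) (n : nat) :
  RCcontinuous f x -> RCcontinuous (fun t => (f t ^ n)%C) x.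
Proof.
  intros H. induction n as [|n IH]; [apply RC_continuous_const|].
  apply (RC_continuous_mult f (fun t => (f t ^ n)%C)); auto.
Qed.

Lemma RC_continuous_RtoC (t : R) : RCcontinuous RtoC t.
Proof.
  apply RC_continuous_eps. intros eps Heps. exists eps. split; [exact Heps|].
  intros y Hy. now rewrite <- RtoC_minus, Cmod_R.
Qed.

Lemma RC_continuous_comp (f : C -> C) (g : R -> C) (t : R) :
  RCcontinuous g t -> ex_Cderive f (g t) ->
  RCcontinuous (fun t => f (g t)) t.
Proof.
  intros Hg Hf. apply RC_continuous_eps. intros eps Heps.
  destruct (C_derive_continuous f (g t) Hf eps Heps) as [d [P H]].
  destruct (proj1 (RC_continuous_eps g t) Hg d P) as [d' [P' H']].
  exists d'. split; [exact P'|]. auto.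
Qed.

(** * Integrals of complex-valued functions of a real variable *)

(** The integral is only real-linear by construction; complex multiples are
    handled through the real and imaginary parts. *)
Lemma is_RInt_Cmult (f : R -> C) (a b : R) (l c : C) :
  is_CRInt f a b l ->
  is_CRInt (fun x => (c * f x)%C) a b (c * l)%C.
Proof.
  intros H.
  pose proof (is_RInt_fct_extend_fst (U := R_NormedModule) (V := R_NormedModule) f a b l H) as H1.
  pose proof (is_RInt_fct_extend_snd (U := R_NormedModule) (V := R_NormedModule) f a b l H) as H2.
  apply (is_RInt_fct_extend_pair (U := R_NormedModule) (V := R_NormedModule)).
  - refine (is_RInt_minus (V := R_NormedModule) _ _ a b _ _ (is_RInt_scal _ a b (fst c) _ H1) (is_RInt_scal _ a b (snd c) _ H2)).
  - refine (is_RInt_plus (V := R_NormedModule) _ _ a b _ _ (is_RInt_scal _ a b (fst c) _ H2) (is_RInt_scal _ a b (snd c) _ H1)).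
Qed.

Lemma is_RInt_Cplus (f g : R -> C) a b l m :
  is_CRInt f a b l -> is_CRInt g a b m ->
  is_CRInt (fun x => (f x + g x)%C) a b (l + m)%C.
Proof. intros. now apply (is_RInt_plus (V := C_R_NormedModule)). Qed.

Lemma is_RInt_Cminus (f g : R -> C) a b l m :
  is_CRInt f a b l -> is_CRInt g a b m ->
  is_CRInt (fun x => (f x - g x)%C) a b (l - m)%C.
Proof. intros. now apply (is_RInt_minus (V := C_R_NormedModule)). Qed.

Lemma is_RInt_Cconj (f : R -> C) (a b : R) (l : C) :
  is_CRInt f a b l ->
  is_CRInt (fun x => Cconj (f x)) a b (Cconj l).
Proof.
  intros H.
  apply (is_RInt_fct_extend_pair (U := R_NormedModule) (V := R_NormedModule)).
  - exact (is_RInt_fct_extend_fst (U := R_NormedModule) (V := R_NormedModule) f a b l H).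
  - apply (is_RInt_opp (V := R_NormedModule) (fun x => snd (f x))).
    exact (is_RInt_fct_extend_snd (U := R_NormedModule) (V := R_NormedModule) f a b l H).
Qed.

Definition CInt (f : R -> C) (a b : R) : C := RInt (V := C_R_CompleteNormedModule) f a b.

Lemma CInt_correct (f : R -> C) (a b : R) :
  (forall x, Rmin a b <= x <= Rmax a b -> RCcontinuous f x) ->
  is_CRInt f a b (CInt f a b).
Proof.
  intros H. apply (RInt_correct (V := C_R_CompleteNormedModule)).
  now apply (ex_RInt_continuous (V := C_R_CompleteNormedModule)).
Qed.

Lemma CInt_bound (f : R -> C) (a b : R) (l : C) (M : R) :
  a <= b -> (forall x, a <= x <= b -> Cmod (f x) <= M) ->
  is_CRInt f a b l -> Cmod l <= (b - a) * M.
Proof.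
  intros Hab HM HI. rewrite <- norm_C_R.
  apply (norm_RInt_le_const f a b l M Hab); [|exact HI].
  intros x Hx. rewrite norm_C_R. auto.
Qed.

Lemma CInt_Chasles (f : R -> C) (a b c : R) :
  a <= b <= c -> (forall x, a <= x <= c -> RCcontinuous f x) ->
  CInt f a c = (CInt f a b + CInt f b c)%C.
Proof.
  intros Habc H. symmetry. apply (RInt_Chasles (V := C_R_CompleteNormedModule)).
  - apply (ex_RInt_continuous (V := C_R_CompleteNormedModule)).
    intros x. rewrite Rmin_left, Rmax_right by lra. intros; apply H; lra.
  - apply (ex_RInt_continuous (V := C_R_CompleteNormedModule)).
    intros x. rewrite Rmin_left, Rmax_right by lra. intros; apply H; lra.
Qed.

Lemma CInt_const (c : C) (a b : R) :
  is_CRInt (fun _ => c) a b (RtoC (b - a) * c)%C.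
Proof.
  replace (RtoC (b - a) * c)%C with (scal (V := C_R_NormedModule) (b - a) c).
  apply (is_RInt_const (V := C_R_NormedModule)).
  destruct c as [c1 c2]. unfold scal; simpl. unfold prod_scal; simpl. unfold scal; simpl. unfold mult; simpl.
  unfold Cmult, RtoC. simpl. f_equal; ring.
Qed.

(** * Goursat's lemma for closed differential forms *)

(** Bisection principle: if a property fails on the whole rectangle it fails on one
    of the four quarters, and so on along a nested sequence whose limit point [(u, v)]
    contradicts the local hypothesis.  Working with rectangles that contain the
    point, rather than with a Lebesgue number of a cover, is what lets a first-order
    expansion at [(u, v)] be compared with the size of the rectangle. *)
Lemma rectangle_bisection (P : R -> R -> R -> R -> Prop) (a b c d : R) :
  a <= b -> c <= d ->
  (forall x1 x2 y1 y2, x1 <= x2 -> y1 <= y2 ->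
     a <= x1 -> x2 <= b -> c <= y1 -> y2 <= d ->
     P x1 ((x1 + x2) / 2) y1 ((y1 + y2) / 2) ->
     P ((x1 + x2) / 2) x2 y1 ((y1 + y2) / 2) ->
     P x1 ((x1 + x2) / 2) ((y1 + y2) / 2) y2 ->
     P ((x1 + x2) / 2) x2 ((y1 + y2) / 2) y2 -> P x1 x2 y1 y2) ->
  (forall u v, a <= u <= b -> c <= v <= d -> exists delta, 0 < delta /\
     forall x1 x2 y1 y2, a <= x1 -> x1 <= u <= x2 -> x2 <= b ->
       c <= y1 -> y1 <= v <= y2 -> y2 <= d ->
       x2 - x1 < delta -> y2 - y1 < delta -> P x1 x2 y1 y2) ->
  P a b c d.
Proof.
  intros Hab Hcd Hquarter Hlocal.
  apply NNPP. intros Hbad.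
  set (W := fun n => (b - a) / 2 ^ n). set (H := fun n => (d - c) / 2 ^ n).
  assert (HW0 : forall n, 0 <= W n).
  { intros n. apply Rmult_le_pos; [lra | left; apply Rinv_0_lt_compat, pow_lt; lra]. }
  assert (HH0 : forall n, 0 <= H n).
  { intros n. apply Rmult_le_pos; [lra | left; apply Rinv_0_lt_compat, pow_lt; lra]. }
  assert (HWS : forall n, W (S n) = W n / 2).
  { intros n. unfold W. simpl. field. apply pow_nonzero; lra. }
  assert (HHS : forall n, H (S n) = H n / 2).
  { intros n. unfold H. simpl. field. apply pow_nonzero; lra. }
  set (good := fun n (q : R * R) =>
    a <= fst q /\ fst q + W n <= b /\ c <= snd q /\ snd q + H n <= d /\
    ~ P (fst q) (fst q + W n) (snd q) (snd q + H n)).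
  assert (Hstep : forall n q, good n q -> exists q', good (S n) q' /\
     fst q <= fst q' /\ fst q' + W (S n) <= fst q + W n /\
     snd q <= snd q' /\ snd q' + H (S n) <= snd q + H n).
  { intros n [x y] (H1 & H2 & H3 & H4 & H5). simpl in *.
    pose proof (HW0 n). pose proof (HH0 n).
    apply NNPP. intros Hno. apply H5.
    assert (forall q', a <= fst q' -> fst q' + W (S n) <= b -> c <= snd q' ->
       snd q' + H (S n) <= d -> x <= fst q' -> fst q' + W (S n) <= x + W n ->
       y <= snd q' -> snd q' + H (S n) <= y + H n ->
       P (fst q') (fst q' + W (S n)) (snd q') (snd q' + H (S n))) as Hall.
    { intros q' A1 A2 A3 A4 A5 A6 A7 A8. apply NNPP. intros A9. apply Hno.
      exists q'. unfold good. tauto. }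
    rewrite HWS, HHS in Hall.
    apply Hquarter; try lra.
    - replace ((x + (x + W n)) / 2) with (x + W n / 2) by lra.
      replace ((y + (y + H n)) / 2) with (y + H n / 2) by lra.
      apply (Hall (x, y)); simpl; lra.
    - replace (x + W n) with ((x + (x + W n)) / 2 + W n / 2) at 2 by lra.
      replace ((y + (y + H n)) / 2) with (y + H n / 2) by lra.
      apply (Hall ((x + (x + W n)) / 2, y)); simpl; lra.
    - replace ((x + (x + W n)) / 2) with (x + W n / 2) by lra.
      replace (y + H n) with ((y + (y + H n)) / 2 + H n / 2) at 2 by lra.
      apply (Hall (x, (y + (y + H n)) / 2)); simpl; lra.
    - replace (x + W n) with ((x + (x + W n)) / 2 + W n / 2) at 2 by lra.
      replace (y + H n) with ((y + (y + H n)) / 2 + H n / 2) at 2 by lra.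
      apply (Hall ((x + (x + W n)) / 2, (y + (y + H n)) / 2)); simpl; lra. }
  (* Dependent choice of the next bad quarter, and the resulting nested sequence. *)
  set (next := fun n q => epsilon (inhabits q) (fun q' => good (S n) q' /\
     fst q <= fst q' /\ fst q' + W (S n) <= fst q + W n /\
     snd q <= snd q' /\ snd q' + H (S n) <= snd q + H n)).
  set (q := fix q n := match n with O => (a, c) | S k => next k (q k) end).
  assert (Hgood : forall n, good n (q n)).
  { induction n as [|n IH].
    - unfold good, W, H. simpl. repeat split; try lra.
      replace (a + (b - a) / 1) with b by lra. replace (c + (d - c) / 1) with d by lra. exact Hbad.
    - exact (proj1 (epsilon_spec (inhabits (q n)) _ (Hstep n (q n) IH))). }
  assert (Hnext : forall n, fst (q n) <= fst (q (S n)) /\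
     fst (q (S n)) + W (S n) <= fst (q n) + W n /\
     snd (q n) <= snd (q (S n)) /\ snd (q (S n)) + H (S n) <= snd (q n) + H n).
  { intros n. exact (proj2 (epsilon_spec (inhabits (q n)) _ (Hstep n (q n) (Hgood n)))). }
  assert (Hmono : forall n k, fst (q n) <= fst (q (n + k)%nat) /\
     fst (q (n + k)%nat) + W (n + k)%nat <= fst (q n) + W n /\
     snd (q n) <= snd (q (n + k)%nat) /\ snd (q (n + k)%nat) + H (n + k)%nat <= snd (q n) + H n).
  { intros n k. induction k as [|k IH].
    - rewrite Nat.add_0_r. lra.
    - rewrite Nat.add_succ_r. pose proof (Hnext (n + k)%nat). lra. }
  assert (Hcross : forall n m, fst (q n) <= fst (q m) + W m /\ snd (q n) <= snd (q m) + H m).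
  { intros n m. destruct (Nat.le_ge_cases n m) as [L|L].
    - pose proof (Hmono n (m - n)%nat) as Hm. replace (n + (m - n))%nat with m in Hm by lia.
      pose proof (HW0 m). pose proof (HH0 m). lra.
    - pose proof (Hmono m (n - m)%nat) as Hm. replace (m + (n - m))%nat with n in Hm by lia.
      pose proof (HW0 n). pose proof (HH0 n). lra. }
  destruct (completeness (fun x => exists n, x = fst (q n))) as [u Hu].
  { exists b. intros x [n ->]. destruct (Hgood n) as (?&?&_). pose proof (HW0 n). lra. }
  { exists a. now exists O. }
  destruct (completeness (fun x => exists n, x = snd (q n))) as [v Hv].
  { exists d. intros x [n ->]. destruct (Hgood n) as (?&?&?&?&_). pose proof (HH0 n). lra. }
  { exists c. now exists O. }
  assert (Hu' : forall n, fst (q n) <= u <= fst (q n) + W n).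
  { intros n. split. apply Hu. now exists n.
    apply Hu. intros x [m ->]. apply Hcross. }
  assert (Hv' : forall n, snd (q n) <= v <= snd (q n) + H n).
  { intros n. split. apply Hv. now exists n.
    apply Hv. intros x [m ->]. apply Hcross. }
  destruct (Hlocal u v) as [delta [Hdelta Hloc]].
  { pose proof (Hu' O) as A. unfold W in A. simpl in A. lra. }
  { pose proof (Hv' O) as A. unfold H in A. simpl in A. lra. }
  assert (Hhalf : forall L, 0 <= L -> exists N, forall n, (N <= n)%nat -> L / 2 ^ n < delta).
  { intros L HL. destruct (pow_lt_1_zero (/ 2)) with (y := delta / (L + 1)) as [N HN].
    - rewrite Rabs_pos_eq; lra.
    - apply Rdiv_lt_0_compat; lra.
    - exists N. intros n Hn. specialize (HN n Hn).
      assert (0 < (/2) ^ n) by (apply pow_lt; lra).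
      rewrite Rabs_pos_eq in HN by lra. unfold Rdiv. rewrite <- pow_inv.
      apply Rmult_lt_compat_r with (r := L + 1) in HN; [|lra].
      unfold Rdiv in HN. rewrite Rmult_assoc, Rinv_l in HN by lra. nra. }
  destruct (Hhalf (b - a)) as [N1 HN1]; [lra|].
  destruct (Hhalf (d - c)) as [N2 HN2]; [lra|].
  set (n := Nat.max N1 N2).
  destruct (Hgood n) as (G1 & G2 & G3 & G4 & G5). apply G5.
  pose proof (HN1 n (Nat.le_max_l _ _)) as A1. pose proof (HN2 n (Nat.le_max_r _ _)) as A2.
  apply Hloc; auto.
  - replace (fst (q n) + W n - fst (q n)) with (W n) by lra. exact A1.
  - replace (snd (q n) + H n - snd (q n)) with (H n) by lra. exact A2.
Qed.

(** The integral of [A dx + B dy] around the rectangle, counterclockwise. *)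
Definition boundary_integral (A B : R -> R -> C) (x1 x2 y1 y2 : R) : C :=
  (CInt (fun x => A x y1) x1 x2 - CInt (fun x => A x y2) x1 x2
   + (CInt (B x2) y1 y2 - CInt (B x1) y1 y2))%C.

(** The hypothesis says that the form is closed at every point, [l] being the common
    value of [dA/dy] and [dB/dx]; the other two partial derivatives cancel in a
    boundary integral, so the corresponding terms may be arbitrary functions [alpha]
    and [beta].  On a small rectangle with sides
    [w] and [h] the boundary integral is [O(eps (w + h)^2)], and this bound is
    preserved when four quarters are put together. *)
Lemma goursat (A B : R -> R -> C) (a b c d : R) :
  a <= b -> c <= d ->
  (forall x y, a <= x <= b -> c <= y <= d -> RCcontinuous (fun x => A x y) x) ->
  (forall x y, a <= x <= b -> c <= y <= d -> RCcontinuous (B x) y) ->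
  (forall u v, a <= u <= b -> c <= v <= d -> exists l : C,
     forall eps, 0 < eps -> exists delta, 0 < delta /\ exists alpha beta : R -> C,
       forall x y, a <= x <= b -> c <= y <= d ->
         Rabs (x - u) < delta -> Rabs (y - v) < delta ->
         Cmod (A x y - alpha x - RtoC (y - v) * l) <= eps * (Rabs (x - u) + Rabs (y - v)) /\
         Cmod (B x y - beta y - RtoC (x - u) * l) <= eps * (Rabs (x - u) + Rabs (y - v))) ->
  boundary_integral A B a b c d = 0%C.
Proof.
  intros Hab Hcd HcA HcB Hloc.
  assert (HA : forall y x1 x2, c <= y <= d -> a <= x1 <= x2 -> x2 <= b ->
     is_CRInt (fun x => A x y) x1 x2 (CInt (fun x => A x y) x1 x2)).
  { intros y x1 x2 Hy H1 H2. apply CInt_correct. intros x Hx.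
    rewrite Rmin_left, Rmax_right in Hx by lra. apply HcA; lra. }
  assert (HB : forall x y1 y2, a <= x <= b -> c <= y1 <= y2 -> y2 <= d ->
     is_CRInt (B x) y1 y2 (CInt (B x) y1 y2)).
  { intros x y1 y2 Hx H1 H2. apply CInt_correct. intros y Hy.
    rewrite Rmin_left, Rmax_right in Hy by lra. apply HcB; lra. }
  apply (Cmod_le_eps_0 _ (4 * ((b - a) + (d - c)) ^ 2)); [nra|].
  intros eps Heps.
  rewrite <- Rmult_assoc. rewrite (Rmult_comm eps 4).
  apply (rectangle_bisection (fun x1 x2 y1 y2 =>
    Cmod (boundary_integral A B x1 x2 y1 y2) <= 4 * eps * ((x2 - x1) + (y2 - y1)) ^ 2)); auto.
  - intros x1 x2 y1 y2 Hx Hy H1 H2 H3 H4 P1 P2 P3 P4.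
    set (xm := (x1 + x2) / 2) in *. set (ym := (y1 + y2) / 2) in *.
    assert (Hxm : x1 <= xm <= x2) by (unfold xm; lra).
    assert (Hym : y1 <= ym <= y2) by (unfold ym; lra).
    replace (boundary_integral A B x1 x2 y1 y2) with
      ((boundary_integral A B x1 xm y1 ym + boundary_integral A B xm x2 y1 ym)
       + (boundary_integral A B x1 xm ym y2 + boundary_integral A B xm x2 ym y2))%C.
    + eapply Rle_trans. apply Cmod_triangle.
      eapply Rle_trans. apply Rplus_le_compat; apply Cmod_triangle.
      assert (E1 : xm - x1 = (x2 - x1) / 2) by (unfold xm; lra).
      assert (E2 : x2 - xm = (x2 - x1) / 2) by (unfold xm; lra).
      assert (E3 : ym - y1 = (y2 - y1) / 2) by (unfold ym; lra).
      assert (E4 : y2 - ym = (y2 - y1) / 2) by (unfold ym; lra).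
      rewrite ?E1, ?E2, ?E3, ?E4 in P1, P2, P3, P4. nra.
    + unfold boundary_integral.
      rewrite (CInt_Chasles (fun x => A x y1) x1 xm x2 Hxm) by (intros; apply HcA; lra).
      rewrite (CInt_Chasles (fun x => A x y2) x1 xm x2 Hxm) by (intros; apply HcA; lra).
      rewrite (CInt_Chasles (B x1) y1 ym y2 Hym) by (intros; apply HcB; lra).
      rewrite (CInt_Chasles (B x2) y1 ym y2 Hym) by (intros; apply HcB; lra).
      ring.
  - intros u v Hu Hv. destruct (Hloc u v Hu Hv) as [l Hl].
    destruct (Hl eps Heps) as [delta [Hdelta [alpha [beta Hest]]]].
    exists delta. split; [exact Hdelta|].
    intros x1 x2 y1 y2 H1 H2 H3 H4 H5 H6 H7 H8.
    assert (Hab1 : forall x, x1 <= x <= x2 -> Rabs (x - u) <= x2 - x1).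
    { intros x Hx. apply Rabs_le. lra. }
    assert (Hab2 : forall y, y1 <= y <= y2 -> Rabs (y - v) <= y2 - y1).
    { intros y Hy. apply Rabs_le. lra. }
    set (s := (x2 - x1) + (y2 - y1)).
    assert (Hs : forall x y, x1 <= x <= x2 -> y1 <= y <= y2 ->
      Cmod (A x y - alpha x - RtoC (y - v) * l) <= eps * s /\
      Cmod (B x y - beta y - RtoC (x - u) * l) <= eps * s).
    { intros x y Hx Hy. pose proof (Hab1 x Hx). pose proof (Hab2 y Hy).
      destruct (Hest x y) as [E1 E2]; try lra.
      assert (eps * (Rabs (x - u) + Rabs (y - v)) <= eps * s) by
        (apply Rmult_le_compat_l; unfold s; lra).
      lra. }
    (* The linear parts contribute opposite multiples of the area. *)
    replace (boundary_integral A B x1 x2 y1 y2) with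
      ((CInt (fun x => A x y1) x1 x2 - CInt (fun x => A x y2) x1 x2 - RtoC (x2 - x1) * (RtoC (y1 - y2) * l))
       + ((CInt (B x2) y1 y2 - CInt (B x1) y1 y2) - RtoC (y2 - y1) * (RtoC (x2 - x1) * l)))%C
      by (unfold boundary_integral; rewrite !RtoC_minus; ring).
    eapply Rle_trans. apply Cmod_triangle.
    assert (B1 : Cmod (CInt (fun x => A x y1) x1 x2 - CInt (fun x => A x y2) x1 x2 - RtoC (x2 - x1) * (RtoC (y1 - y2) * l))%C <= (x2 - x1) * (2 * eps * s)).
    { eapply CInt_bound with (f := fun x => (A x y1 - A x y2 - RtoC (y1 - y2) * l)%C); [lra| |].
      - intros x Hx. destruct (Hs x y1) as [E1 _]; try lra. destruct (Hs x y2) as [E2 _]; try lra.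
        replace (A x y1 - A x y2 - RtoC (y1 - y2) * l)%C with
          ((A x y1 - alpha x - RtoC (y1 - v) * l) - (A x y2 - alpha x - RtoC (y2 - v) * l))%C
          by (rewrite !RtoC_minus; ring).
        eapply Rle_trans. apply Cmod_minus_triangle. lra.
      - apply is_RInt_Cminus; [|apply CInt_const].
        apply is_RInt_Cminus; apply HA; lra. }
    assert (B2 : Cmod (CInt (B x2) y1 y2 - CInt (B x1) y1 y2 - RtoC (y2 - y1) * (RtoC (x2 - x1) * l))%C <= (y2 - y1) * (2 * eps * s)).
    { eapply CInt_bound with (f := fun y => (B x2 y - B x1 y - RtoC (x2 - x1) * l)%C); [lra| |].
      - intros y Hy. destruct (Hs x1 y) as [_ E1]; try lra. destruct (Hs x2 y) as [_ E2]; try lra.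
        replace (B x2 y - B x1 y - RtoC (x2 - x1) * l)%C with
          ((B x2 y - beta y - RtoC (x2 - u) * l) - (B x1 y - beta y - RtoC (x1 - u) * l))%C
          by (rewrite !RtoC_minus; ring).
        eapply Rle_trans. apply Cmod_minus_triangle. lra.
      - apply is_RInt_Cminus; [|apply CInt_const].
        apply is_RInt_Cminus; apply HB; lra. }
    assert (0 <= eps * s ^ 2) by (apply Rmult_le_pos; [lra | apply pow2_ge_0]).
    fold s.
    replace (4 * eps * s ^ 2) with ((x2 - x1) * (2 * eps * s) + (y2 - y1) * (2 * eps * s) + 2 * (eps * s ^ 2)) by (unfold s; ring).
    lra.
Qed.

(** * The unit circle *)

Definition cis (t : R) : C := (cos t, sin t).

Lemma Cmod_cis (t : R) : Cmod (cis t) = 1.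
Proof.
  unfold Cmod, cis. simpl.
  replace (cos t * (cos t * 1) + sin t * (sin t * 1)) with 1
    by (pose proof (sin2_cos2 t) as H; unfold Rsqr in H; lra).
  apply sqrt_1.
Qed.

Lemma cis_plus (s t : R) : cis (s + t) = (cis s * cis t)%C.
Proof. unfold cis, Cmult. simpl. rewrite cos_plus, sin_plus. f_equal; ring. Qed.

Lemma cis_0 : cis 0 = 1%C.
Proof. unfold cis. now rewrite cos_0, sin_0. Qed.

Lemma cis_2PI : cis (2 * PI) = 1%C.
Proof. unfold cis. now rewrite cos_2PI, sin_2PI. Qed.

Lemma cis_pow (t : R) (n : nat) : (cis t ^ n)%C = cis (INR n * t).
Proof.
  induction n as [|n IH].
  - simpl. now rewrite Rmult_0_l, cis_0.
  - rewrite Cpow_S, IH, <- cis_plus, S_INR. f_equal. ring.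
Qed.

Lemma cis_conj (t : R) : Cconj (cis t) = cis (- t).
Proof. unfold Cconj, cis. simpl. now rewrite cos_neg, sin_neg. Qed.

Lemma cis_cancel (t : R) (k m : nat) : (k <= m)%nat ->
  (cis t ^ k * cis (- t) ^ m = cis (- t) ^ (m - k))%C.
Proof.
  intros Hkm. replace m with (k + (m - k))%nat at 1 by lia.
  rewrite Cpow_add_r, Cmult_assoc, <- Cpow_mult_l, <- cis_plus, Rplus_opp_r, cis_0, Cpow_1_l. ring.
Qed.

Lemma cis_derive_eps (t eps : R) :
  0 < eps -> exists delta, 0 < delta /\ forall y, Rabs (y - t) < delta ->
    Cmod (cis y - cis t - RtoC (y - t) * (Ci * cis t)) <= eps * Rabs (y - t).
Proof.
  intros Heps.
  destruct (R_derive_eps cos t (- sin t) (is_derive_cos t) (eps / 2)) as [d1 [P1 H1]]; [lra|].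
  destruct (R_derive_eps sin t (cos t) (is_derive_sin t) (eps / 2)) as [d2 [P2 H2]]; [lra|].
  exists (Rmin d1 d2). split. now apply Rmin_pos.
  intros y Hy.
  specialize (H1 y (Rlt_le_trans _ _ _ Hy (Rmin_l _ _))).
  specialize (H2 y (Rlt_le_trans _ _ _ Hy (Rmin_r _ _))).
  eapply Rle_trans. apply Cmod_le_Rabs.
  unfold cis, Ci, RtoC, Cmult, Cminus, Cplus, Copp in *. simpl in *.
  match goal with |- Rabs ?a + Rabs ?b <= _ =>
    replace a with (cos y - cos t - (y - t) * - sin t) by ring;
    replace b with (sin y - sin t - (y - t) * cos t) by ring end.
  lra.
Qed.

Lemma cis_lipschitz_near (t : R) : exists delta, 0 < delta /\ forall y, Rabs (y - t) < delta ->
    Cmod (cis y - cis t) <= 2 * Rabs (y - t).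
Proof.
  destruct (cis_derive_eps t 1 Rlt_0_1) as [d [P H]].
  exists d. split; [exact P|]. intros y Hy. specialize (H y Hy).
  replace (cis y - cis t)%C with ((cis y - cis t - RtoC (y - t) * (Ci * cis t)) + RtoC (y - t) * (Ci * cis t))%C by ring.
  eapply Rle_trans. apply Cmod_triangle.
  rewrite !Cmod_mult, Cmod_R, Cmod_Ci, Cmod_cis. lra.
Qed.

Lemma RC_continuous_cis (s t : R) : RCcontinuous (fun t => cis (s * t)) t.
Proof.
  apply (continuous_comp (U := R_UniformSpace) (V := R_UniformSpace) (fun t => s * t) cis).
  - apply (continuous_scal_r (V := R_NormedModule) s (fun t => t)). apply continuous_id.
  - apply RC_continuous_eps. intros eps Heps.
    destruct (cis_lipschitz_near (s * t)) as [d [P H]].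
    exists (Rmin d (eps / 2)). split; [apply Rmin_pos; lra|].
    intros y Hy. pose proof (Rlt_le_trans _ _ _ Hy (Rmin_r _ _)).
    specialize (H y (Rlt_le_trans _ _ _ Hy (Rmin_l _ _))). lra.
Qed.

(** Orthogonality of the characters of the circle. *)
Lemma is_RInt_cis_pow (n : nat) : (0 < n)%nat ->
  is_CRInt (fun th => (cis (- th) ^ n)%C) 0 (2 * PI) (RtoC 0).
Proof.
  intros Hn. assert (Hn' : INR n <> 0) by (apply not_0_INR; lia).
  assert (Hs : sin (INR n * (2 * PI)) = 0 /\ cos (INR n * (2 * PI)) = 1).
  { pose proof (sin_period 0 n) as A. pose proof (cos_period 0 n) as B.
    rewrite sin_0 in A. rewrite cos_0 in B.
    replace (0 + 2 * INR n * PI) with (INR n * (2 * PI)) in A, B by ring. auto. }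
  apply (is_RInt_ext (V := C_R_NormedModule) (fun th => (cos (INR n * th), - sin (INR n * th)))).
  { intros th _. rewrite cis_pow. unfold cis.
    replace (INR n * - th) with (- (INR n * th)) by ring. now rewrite cos_neg, sin_neg. }
  apply (is_RInt_fct_extend_pair (U := R_NormedModule) (V := R_NormedModule)); simpl.
  - replace 0 with (minus (sin (INR n * (2 * PI)) / INR n) (sin (INR n * 0) / INR n)) at 2.
    2: { rewrite (proj1 Hs), Rmult_0_r, sin_0. unfold minus, plus, opp; simpl. field; auto. }
    apply (is_RInt_derive (V := R_CompleteNormedModule) (fun th => sin (INR n * th) / INR n)).
    + intros x _. auto_derive; auto. field. auto.
    + intros x _. apply (ex_derive_continuous (fun th => cos (INR n * th))). auto_derive; auto.
  - replace 0 with (minus (cos (INR n * (2 * PI)) / INR n) (cos (INR n * 0) / INR n)) at 2.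
    2: { rewrite (proj2 Hs), Rmult_0_r, cos_0. unfold minus, plus, opp; simpl. field; auto. }
    apply (is_RInt_derive (V := R_CompleteNormedModule) (fun th => cos (INR n * th) / INR n)).
    + intros x _. auto_derive; auto. field. auto.
    + intros x _. apply (ex_derive_continuous (fun th => - sin (INR n * th))). auto_derive; auto.
Qed.

(** * Cauchy's formula on circles about the origin *)

(** At time [t] the circle of radius [r] about 0 has been shrunk towards [z0] by the factor [t]. *)
Definition contraction (z0 : C) (r t th : R) : C :=
  (z0 + RtoC t * (RtoC r * cis th - z0))%C.

Lemma contraction_in_disk (z0 : C) (r t th : R) :
  0 < r < 1 -> Cmod z0 < r -> 0 <= t <= 1 -> Cmod (contraction z0 r t th) < 1.
Proof.
  intros Hr Hz Ht. unfold contraction.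
  replace (z0 + RtoC t * (RtoC r * cis th - z0))%C with
    (RtoC (1 - t) * z0 + RtoC t * (RtoC r * cis th))%C by (rewrite RtoC_minus; ring).
  eapply Rle_lt_trans. apply Cmod_triangle.
  rewrite !Cmod_mult, !Cmod_R, Cmod_cis, !Rabs_pos_eq by lra. nra.
Qed.

Lemma contraction_expansion (f : C -> C) (r u v : R) (z0 l : C) :
  0 < r <= 1 -> Cmod z0 <= 1 -> 0 <= u <= 1 ->
  is_Cderive f (contraction z0 r u v) l ->
  forall eps, 0 < eps -> exists delta, 0 < delta /\ forall x y,
    0 <= x <= 1 -> Rabs (x - u) < delta -> Rabs (y - v) < delta ->
    Cmod (f (contraction z0 r x y) - f (contraction z0 r u v)
          - (RtoC (x - u) * (RtoC r * cis v - z0)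
             + RtoC (y - v) * (RtoC u * RtoC r * Ci * cis v)) * l)
      <= eps * (Rabs (x - u) + Rabs (y - v)).
Proof.
  intros Hr Hz0 Hu Hl eps Heps.
  pose proof (Cmod_ge_0 l) as HL.
  destruct (small_multiple eps (4 + 3 * Cmod l)) as [eta [He1 He2]]; [lra|lra|].
  destruct (proj1 (C_derive_eps f _ l) Hl eta) as [d1 [P1 H1]]; [lra|].
  destruct (cis_derive_eps v eta) as [d2 [P2 H2]]; [lra|].
  destruct (cis_lipschitz_near v) as [d3 [P3 H3]].
  exists (Rmin (Rmin eta (d1 / 4)) (Rmin d2 d3)). split.
  { repeat apply Rmin_pos; lra. }
  intros x y Hx Hxu Hyv.
  assert (Hxu1 : Rabs (x - u) < eta).
  { eapply Rlt_le_trans. exact Hxu. eapply Rle_trans; [apply Rmin_l|apply Rmin_l]. }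
  assert (Hxu2 : Rabs (x - u) < d1 / 4).
  { eapply Rlt_le_trans. exact Hxu. eapply Rle_trans; [apply Rmin_l|apply Rmin_r]. }
  assert (Hyv2 : Rabs (y - v) < d1 / 4).
  { eapply Rlt_le_trans. exact Hyv. eapply Rle_trans; [apply Rmin_l|apply Rmin_r]. }
  assert (Hyv3 : Rabs (y - v) < d2).
  { eapply Rlt_le_trans. exact Hyv. eapply Rle_trans; [apply Rmin_r|apply Rmin_l]. }
  assert (Hyv4 : Rabs (y - v) < d3).
  { eapply Rlt_le_trans. exact Hyv. eapply Rle_trans; [apply Rmin_r|apply Rmin_r]. }
  specialize (H2 y Hyv3). specialize (H3 y Hyv4).
  pose proof (Rabs_pos (x - u)) as Ax. pose proof (Rabs_pos (y - v)) as Ay.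
  set (s := Rabs (x - u) + Rabs (y - v)).
  set (D := (contraction z0 r x y - contraction z0 r u v)%C).
  assert (ED : D = (RtoC (x - u) * (RtoC r * cis v - z0) + RtoC x * RtoC r * (cis y - cis v))%C).
  { unfold D, contraction. rewrite RtoC_minus. ring. }
  assert (HD : Cmod D <= 2 * s).
  { rewrite ED. eapply Rle_trans. apply Cmod_triangle.
    rewrite !Cmod_mult, !Cmod_R, (Rabs_pos_eq x), (Rabs_pos_eq r) by lra.
    pose proof (Cmod_minus_triangle (RtoC r * cis v) z0) as T.
    rewrite Cmod_mult, Cmod_R, Cmod_cis, (Rabs_pos_eq r) in T by lra.
    pose proof (Cmod_ge_0 (cis y - cis v)).
    assert (x * r <= 1) by nra. assert (0 <= x * r) by nra.
    unfold s. nra. }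
  set (lin := (RtoC (x - u) * (RtoC r * cis v - z0) + RtoC (y - v) * (RtoC u * RtoC r * Ci * cis v))%C).
  assert (Hrem : Cmod (D - lin) <= 3 * eta * s).
  { replace (D - lin)%C with
      (RtoC (x - u) * RtoC r * (cis y - cis v)
       + RtoC u * RtoC r * (cis y - cis v - RtoC (y - v) * (Ci * cis v)))%C
      by (rewrite ED; unfold lin; rewrite RtoC_minus; ring).
    eapply Rle_trans. apply Cmod_triangle.
    rewrite !Cmod_mult, !Cmod_R, (Rabs_pos_eq u), (Rabs_pos_eq r) by lra.
    pose proof (Cmod_ge_0 (cis y - cis v)).
    assert (Rabs (x - u) * r <= eta) by nra.
    assert (0 <= Rabs (x - u) * r) by nra.
    assert (u * r <= 1) by nra. assert (0 <= u * r) by nra.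
    pose proof (Cmod_ge_0 (cis y - cis v - RtoC (y - v) * (Ci * cis v))) as Hc.
    set (c2 := Cmod (cis y - cis v - RtoC (y - v) * (Ci * cis v))) in *.
    apply Rle_trans with (eta * (2 * Rabs (y - v)) + 1 * (eta * Rabs (y - v))).
    - apply Rplus_le_compat; apply Rmult_le_compat; auto.
    - unfold s. nra. }
  replace (f (contraction z0 r x y) - f (contraction z0 r u v) - lin * l)%C with
    ((f (contraction z0 r x y) - f (contraction z0 r u v) - D * l) + (D - lin) * l)%C by ring.
  eapply Rle_trans. apply Cmod_triangle. rewrite Cmod_mult.
  assert (Hf : Cmod (f (contraction z0 r x y) - f (contraction z0 r u v) - D * l) <= eta * Cmod D).
  { apply H1. fold D. unfold s in HD. lra. }
  assert (0 <= s) by (unfold s; lra).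
  assert (eta * Cmod D <= eta * (2 * s)) by (apply Rmult_le_compat_l; lra).
  assert (Cmod (D - lin) * Cmod l <= 3 * eta * s * Cmod l) by (apply Rmult_le_compat_r; lra).
  assert (eta * (4 + 3 * Cmod l) * s <= eps * s) by (apply Rmult_le_compat_r; lra).
  nra.
Qed.

Lemma RC_continuous_contraction_t (z0 : C) (r t th : R) :
  RCcontinuous (fun t => contraction z0 r t th) t.
Proof.
  apply RC_continuous_plus; [apply RC_continuous_const|].
  apply RC_continuous_mult; [|apply RC_continuous_const].
  apply RC_continuous_eps. intros eps Heps. exists eps. split; [exact Heps|].
  intros y Hy. now rewrite <- RtoC_minus, Cmod_R.
Qed.

Lemma RC_continuous_contraction_th (z0 : C) (r t th : R) :
  RCcontinuous (contraction z0 r t) th.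
Proof.
  apply RC_continuous_plus; [apply RC_continuous_const|].
  apply RC_continuous_mult; [apply RC_continuous_const|].
  apply RC_continuous_minus; [|apply RC_continuous_const].
  apply RC_continuous_mult; [apply RC_continuous_const|].
  apply (continuous_ext (fun t => cis (1 * t))). { intros s. f_equal. ring. }
  apply RC_continuous_cis.
Qed.

(** This is [z0 / zeta] for [zeta] on the circle; Cauchy's kernel
    [zeta / (zeta - z0)] is the sum of its powers. *)
Definition cauchy_ratio (z0 : C) (r th : R) : C := (z0 / RtoC r * cis (- th))%C.

Lemma Cmod_cauchy_ratio (z0 : C) (r th : R) : 0 < r -> Cmod (cauchy_ratio z0 r th) = Cmod z0 / r.
Proof.
  intros Hr. unfold cauchy_ratio.
  rewrite Cmod_mult, Cmod_cis, Cmod_div, Cmod_R, Rabs_pos_eq, Rmult_1_r; [reflexivity|lra|].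
  intros E. apply RtoC_inj in E. lra.
Qed.

Lemma RC_continuous_cauchy_ratio (z0 : C) (r th : R) : RCcontinuous (cauchy_ratio z0 r) th.
Proof.
  apply RC_continuous_mult; [apply RC_continuous_const|].
  apply (continuous_ext (fun t => cis (-1 * t))). { intros t. f_equal. ring. }
  apply RC_continuous_cis.
Qed.

Lemma cis_cauchy_ratio (z0 : C) (r th : R) : 0 < r ->
  (RtoC r * cis th * (1 - cauchy_ratio z0 r th) = RtoC r * cis th - z0)%C.
Proof.
  intros Hr. unfold cauchy_ratio.
  assert (E : (cis th * cis (- th) = 1)%C).
  { rewrite <- cis_plus, Rplus_opp_r. apply cis_0. }
  assert (Hr0 : RtoC r <> 0%C). { intros E0. apply RtoC_inj in E0. lra. }
  replace (RtoC r * cis th * (1 - z0 / RtoC r * cis (- th)))%C with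
    (RtoC r * cis th - z0 * (cis th * cis (- th)))%C by (field; exact Hr0).
  rewrite E. ring.
Qed.

(** With [homotopy_dth], the two components of the pull-back of
    [(f(z) - f(z0)) / (i (z - z0)) dz] along [contraction]: there [z - z0] is
    [t (zeta - z0)], which gives [dz / (z - z0) = dt / t + dzeta / (zeta - z0)]. *)
Definition homotopy_dt (f : C -> C) (z0 : C) (r t th : R) : C :=
  (- Ci * (f (contraction z0 r t th) - f z0) * / RtoC t)%C.

Definition homotopy_dth (f : C -> C) (z0 : C) (r t th : R) : C :=
  ((f (contraction z0 r t th) - f z0) * / (1 - cauchy_ratio z0 r th))%C.

Section Cauchy.

Variables (f : C -> C) (r : R) (z0 : C).
Hypotheses (hf : analytic_on_disk f) (hr : 0 < r < 1) (hz0 : Cmod z0 < r).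

Lemma cauchy_ratio_lt_1 th : Cmod (cauchy_ratio z0 r th) <= Cmod z0 / r /\ Cmod z0 / r < 1.
Proof.
  rewrite Cmod_cauchy_ratio by lra. split; [lra|].
  apply Rlt_div_l; lra.
Qed.

Lemma homotopy_dth_continuous t th : 0 <= t <= 1 -> RCcontinuous (homotopy_dth f z0 r t) th.
Proof.
  intros Ht. apply RC_continuous_mult.
  - apply RC_continuous_minus; [|apply RC_continuous_const].
    apply (RC_continuous_comp f (contraction z0 r t)).
    + apply RC_continuous_contraction_th.
    + apply hf, contraction_in_disk; auto.
  - apply RC_continuous_inv.
    + apply RC_continuous_minus; [apply RC_continuous_const|apply RC_continuous_cauchy_ratio].
    + destruct (cauchy_ratio_lt_1 th). eapply one_minus_bound; eauto.
Qed.

Lemma homotopy_dt_continuous t th : 0 < t <= 1 -> RCcontinuous (fun t => homotopy_dt f z0 r t th) t.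
Proof.
  intros Ht. apply RC_continuous_mult.
  - apply RC_continuous_mult; [apply RC_continuous_const|].
    apply RC_continuous_minus; [|apply RC_continuous_const].
    apply (RC_continuous_comp f (fun t => contraction z0 r t th)).
    + apply RC_continuous_contraction_t.
    + apply hf, contraction_in_disk; auto; lra.
  - apply RC_continuous_inv; [apply RC_continuous_RtoC|].
    intros E. apply RtoC_inj in E. lra.
Qed.

(** The mixed partial derivatives agree: both are [f'(z) zeta].  In the first
    component the factor [1 / t], and in the second the kernel, need only be
    continuous, since the expansions may have arbitrary terms in the other variable. *)
Lemma homotopy_closed (tau u v : R) : 0 < tau -> tau <= u <= 1 ->
  exists l : C, forall eps, 0 < eps -> exists delta, 0 < delta /\ exists alpha beta : R -> C,
    forall x y, tau <= x <= 1 -> Rabs (x - u) < delta -> Rabs (y - v) < delta ->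
      Cmod (homotopy_dt f z0 r x y - alpha x - RtoC (y - v) * l)
        <= eps * (Rabs (x - u) + Rabs (y - v)) /\
      Cmod (homotopy_dth f z0 r x y - beta y - RtoC (x - u) * l)
        <= eps * (Rabs (x - u) + Rabs (y - v)).
Proof.
  intros Htau Hu.
  destruct (hf (contraction z0 r u v)) as [l Hl].
  { apply contraction_in_disk; auto; lra. }
  exists (l * (RtoC r * cis v))%C. intros eps Heps.
  pose proof (Cmod_ge_0 l) as HL.
  set (k := fun th => (/ (1 - cauchy_ratio z0 r th))%C).
  destruct (cauchy_ratio_lt_1 v) as [_ Hrho].
  set (K := / (1 - Cmod z0 / r)).
  assert (HK : 0 < K) by (apply Rinv_0_lt_compat; lra).
  assert (Hk : forall th, Cmod (k th) <= K).
  { intros th. eapply one_minus_bound; [apply cauchy_ratio_lt_1 | exact Hrho]. }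
  assert (Hkc : RCcontinuous k v).
  { apply RC_continuous_inv.
    - apply RC_continuous_minus; [apply RC_continuous_const|apply RC_continuous_cauchy_ratio].
    - destruct (cauchy_ratio_lt_1 v). eapply one_minus_bound; eauto. }
  assert (Htau' : 0 < / tau) by (now apply Rinv_0_lt_compat).
  destruct (small_multiple eps ((1 + 2 * Cmod l) * (/ tau + K + 1))) as [eta [He1 He2]].
  { exact Heps. } { apply Rmult_le_pos; lra. }
  destruct (contraction_expansion f r u v z0 l) with (eps := eta) as [d1 [P1 H1]]; try lra.
  { exact Hl. }
  destruct (proj1 (RC_continuous_eps k v) Hkc eta) as [d2 [P2 H2]]; [lra|].
  exists (Rmin eta (Rmin d1 d2)). split. { repeat apply Rmin_pos; lra. }
  set (F0 := (f (contraction z0 r u v) - f z0)%C).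
  exists (fun x => (- Ci * (F0 + RtoC (x - u) * (RtoC r * cis v - z0) * l) * / RtoC x)%C).
  exists (fun y => ((F0 + RtoC (y - v) * (RtoC u * RtoC r * Ci * cis v) * l) * k y)%C).
  intros x y Hx Hxu Hyv.
  assert (Hxu1 : Rabs (x - u) < eta) by (eapply Rlt_le_trans; [exact Hxu|apply Rmin_l]).
  assert (Hxu2 : Rabs (x - u) < d1).
  { eapply Rlt_le_trans. exact Hxu. eapply Rle_trans; [apply Rmin_r|apply Rmin_l]. }
  assert (Hyv1 : Rabs (y - v) < d1).
  { eapply Rlt_le_trans. exact Hyv. eapply Rle_trans; [apply Rmin_r|apply Rmin_l]. }
  assert (Hyv2 : Rabs (y - v) < d2).
  { eapply Rlt_le_trans. exact Hyv. eapply Rle_trans; [apply Rmin_r|apply Rmin_r]. }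
  specialize (H1 x y ltac:(lra) Hxu2 Hyv1). specialize (H2 y Hyv2).
  pose proof (Rabs_pos (x - u)) as Ax. pose proof (Rabs_pos (y - v)) as Ay.
  set (s := Rabs (x - u) + Rabs (y - v)) in *.
  assert (Hs : 0 <= s) by (unfold s; lra).
  assert (Hx0 : RtoC x <> 0%C). { intros E. apply RtoC_inj in E. lra. }
  set (E := (f (contraction z0 r x y) - f (contraction z0 r u v)
          - (RtoC (x - u) * (RtoC r * cis v - z0)
             + RtoC (y - v) * (RtoC u * RtoC r * Ci * cis v)) * l)%C) in *.
  assert (EF : (f (contraction z0 r x y) - f z0)%C =
     (F0 + (RtoC (x - u) * (RtoC r * cis v - z0)
             + RtoC (y - v) * (RtoC u * RtoC r * Ci * cis v)) * l + E)%C)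
    by (unfold E, F0; ring).
  assert (Hbig : eta * ((1 + 2 * Cmod l) * (/ tau + K + 1)) * s <= eps * s)
    by (apply Rmult_le_compat_r; lra).
  assert (HinvX : Cmod (/ RtoC x) <= / tau).
  { rewrite Cmod_inv by exact Hx0. rewrite Cmod_R, Rabs_pos_eq by lra.
    apply Rinv_le_contravar; lra. }
  pose proof (Cmod_ge_0 (/ RtoC x)) as HinvX0.
  pose proof (Cmod_ge_0 E) as HE0.
  assert (HetaS : 0 <= eta * s) by (apply Rmult_le_pos; lra).
  assert (HetaSL : 0 <= eta * s * Cmod l) by (apply Rmult_le_pos; lra).
  split.
  - unfold homotopy_dt. rewrite EF.
    match goal with |- Cmod ?w <= _ =>
      replace w with ((- Ci * E * / RtoC x)
        + RtoC (u - x) * / RtoC x * (RtoC (y - v) * (l * (RtoC r * cis v))))%C end.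
    2: { replace (RtoC (y - v) * (RtoC u * RtoC r * Ci * cis v))%C
           with (Ci * (RtoC (y - v) * (RtoC u * RtoC r * cis v)))%C by ring.
         assert (I2 : (Ci * Ci)%C = (- (1))%C).
         { unfold Ci, Cmult, Copp, RtoC. simpl. f_equal; ring. }
         rewrite (RtoC_minus u x).
         transitivity (- Ci * E * / RtoC x + RtoC (y - v) * RtoC u * / RtoC x * (l * (RtoC r * cis v)) - RtoC (y - v) * (l * (RtoC r * cis v)))%C.
         - field. exact Hx0.
         - transitivity (- Ci * E * / RtoC x - (Ci * Ci) * RtoC (y - v) * RtoC u * / RtoC x * (l * (RtoC r * cis v)) - RtoC (y - v) * (l * (RtoC r * cis v)))%C.
           + rewrite I2. ring.
           + ring. }
    eapply Rle_trans. apply Cmod_triangle.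
    rewrite !Cmod_mult, !Cmod_opp, Cmod_Ci, !Cmod_R, Cmod_cis, (Rabs_pos_eq r) by lra.
    rewrite (Rabs_minus_sym u x).
    assert (Q1 : 1 * Cmod E * Cmod (/ RtoC x) <= eta * s * / tau).
    { rewrite Rmult_1_l. apply Rmult_le_compat; lra. }
    assert (Q2 : Rabs (x - u) * Cmod (/ RtoC x) * (Rabs (y - v) * (Cmod l * (r * 1)))
       <= eta * / tau * (s * Cmod l)).
    { apply Rmult_le_compat.
      - apply Rmult_le_pos; lra.
      - apply Rmult_le_pos; [lra|]. apply Rmult_le_pos; lra.
      - apply Rmult_le_compat; lra.
      - apply Rmult_le_compat; [lra| |unfold s; lra|].
        + apply Rmult_le_pos; lra.
        + rewrite Rmult_1_r. rewrite <- (Rmult_1_r (Cmod l)) at 2.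
          apply Rmult_le_compat_l; lra. }
    assert (0 <= eta * s * / tau) by (apply Rmult_le_pos; lra).
    assert (0 <= eta * s * Cmod l * / tau) by (apply Rmult_le_pos; lra).
    assert (0 <= eta * s * Cmod l * K) by (apply Rmult_le_pos; lra).
    assert (0 <= eta * s * K) by (apply Rmult_le_pos; lra).
    nra.
  - unfold homotopy_dth. rewrite EF. fold (k y).
    (* [r cis v - z0 = r cis v (1 - ratio)], so only the variation of the kernel remains. *)
    assert (Ekv : ((RtoC r * cis v - z0) * k v = RtoC r * cis v)%C).
    { rewrite <- cis_cauchy_ratio by lra. unfold k.
      destruct (cauchy_ratio_lt_1 v) as [q1 q2].
      destruct (one_minus_bound _ _ q1 q2) as [q3 _]. field. exact q3. }
    match goal with |- Cmod ?w <= _ =>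
      replace w with (E * k y + RtoC (x - u) * (RtoC r * cis v - z0) * l * (k y - k v))%C end.
    2: { rewrite <- Ekv at 3. ring. }
    eapply Rle_trans. apply Cmod_triangle.
    rewrite !Cmod_mult, !Cmod_R.
    pose proof (Cmod_minus_triangle (RtoC r * cis v) z0) as T.
    rewrite Cmod_mult, Cmod_R, Cmod_cis, (Rabs_pos_eq r) in T by lra.
    assert (Q1 : Cmod E * Cmod (k y) <= eta * s * K).
    { apply Rmult_le_compat; auto using Cmod_ge_0. }
    assert (Q2 : Rabs (x - u) * Cmod (RtoC r * cis v - z0) * Cmod l * Cmod (k y - k v)
       <= s * 2 * Cmod l * eta).
    { pose proof (Cmod_ge_0 (RtoC r * cis v - z0)).
      apply Rmult_le_compat; auto using Cmod_ge_0.
      - apply Rmult_le_pos; [|lra]. apply Rmult_le_pos; lra.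
      - apply Rmult_le_compat_r; [lra|]. apply Rmult_le_compat; try lra. unfold s; lra.
      - lra. }
    assert (0 <= eta * s * / tau) by (apply Rmult_le_pos; lra).
    assert (0 <= eta * s * Cmod l * / tau) by (apply Rmult_le_pos; lra).
    assert (0 <= eta * s * Cmod l * K) by (apply Rmult_le_pos; lra).
    nra.
Qed.

(** The two sides of the rectangle at [theta = 0] and [theta = 2 PI] cancel by
    periodicity. *)
Lemma homotopy_invariance (tau : R) : 0 < tau <= 1 ->
  CInt (homotopy_dth f z0 r 1) 0 (2 * PI) = CInt (homotopy_dth f z0 r tau) 0 (2 * PI).
Proof.
  intros Htau. pose proof PI_RGT_0.
  assert (G : boundary_integral (homotopy_dt f z0 r) (homotopy_dth f z0 r) tau 1 0 (2 * PI) = 0%C).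
  { apply goursat; try lra.
    - intros x y Hx Hy. apply homotopy_dt_continuous; lra.
    - intros x y Hx Hy. apply homotopy_dth_continuous; lra.
    - intros u v Hu Hv. destruct (homotopy_closed tau u v) as [l Hl]; try lra.
      exists l. intros eps Heps. destruct (Hl eps Heps) as [d [P [al [be Hd]]]].
      exists d. split; [exact P|]. exists al, be. auto. }
  unfold boundary_integral in G.
  assert (E : CInt (fun x => homotopy_dt f z0 r x (2 * PI)) tau 1 = CInt (fun x => homotopy_dt f z0 r x 0) tau 1).
  { apply (RInt_ext (V := C_R_CompleteNormedModule)). intros x _.
    unfold homotopy_dt, contraction. now rewrite cis_0, cis_2PI. }
  rewrite E in G.
  set (a := CInt (homotopy_dth f z0 r 1) 0 (2 * PI)) in *.
  set (b := CInt (homotopy_dth f z0 r tau) 0 (2 * PI)) in *.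
  set (c := CInt (fun x => homotopy_dt f z0 r x 0) tau 1) in *.
  replace a with ((c - c + (a - b)) + b)%C by ring. rewrite G. ring.
Qed.

(** Cauchy's formula: the integral does not change as the circle shrinks to [z0],
    where [f - f(z0)] becomes uniformly small. *)
Lemma cauchy_kernel :
  is_CRInt
    (fun th => ((f (RtoC r * cis th) - f z0) * / (1 - cauchy_ratio z0 r th))%C) 0 (2 * PI) (RtoC 0).
Proof.
  pose proof PI_RGT_0 as HPI.
  assert (HI : forall t, 0 <= t <= 1 -> is_CRInt (homotopy_dth f z0 r t) 0 (2 * PI)
     (CInt (homotopy_dth f z0 r t) 0 (2 * PI))).
  { intros t Ht. apply CInt_correct. intros. now apply homotopy_dth_continuous. }
  assert (E0 : CInt (homotopy_dth f z0 r 1) 0 (2 * PI) = RtoC 0).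
  { destruct (cauchy_ratio_lt_1 0) as [_ Hrho].
    set (K := / (1 - Cmod z0 / r)).
    assert (HK : 0 < K) by (apply Rinv_0_lt_compat; lra).
    apply (Cmod_le_eps_0 _ (2 * PI * K)); [nra|].
    intros eps Heps.
    destruct (C_derive_continuous f z0) with (eps := eps) as [d [P H]]; auto.
    { apply hf. unfold in_disk. lra. }
    assert (Ht : 0 < Rmin 1 (d / 4) <= 1).
    { split; [apply Rmin_pos; lra | apply Rmin_l]. }
    set (tau := Rmin 1 (d / 4)) in *.
    rewrite (homotopy_invariance tau Ht).
    replace (eps * (2 * PI * K)) with ((2 * PI - 0) * (eps * K)) by ring.
    eapply CInt_bound; [lra| |apply HI; lra].
    intros th _. unfold homotopy_dth. rewrite Cmod_mult.
    apply Rmult_le_compat; auto using Cmod_ge_0.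
    - left. apply H. unfold contraction.
      replace (z0 + RtoC tau * (RtoC r * cis th - z0) - z0)%C with (RtoC tau * (RtoC r * cis th - z0))%C by ring.
      rewrite Cmod_mult, Cmod_R, Rabs_pos_eq by lra.
      pose proof (Cmod_minus_triangle (RtoC r * cis th) z0) as T.
      rewrite Cmod_mult, Cmod_R, Cmod_cis, (Rabs_pos_eq r) in T by lra.
      assert (tau <= d / 4) by apply Rmin_r. pose proof (Cmod_ge_0 (RtoC r * cis th - z0)). nra.
    - eapply one_minus_bound; [apply cauchy_ratio_lt_1 | exact Hrho]. }
  rewrite <- E0.
  apply (is_RInt_ext (V := C_R_NormedModule) (homotopy_dth f z0 r 1)); [|apply HI; lra].
  intros th _. unfold homotopy_dth, contraction.
  replace (z0 + RtoC 1 * (RtoC r * cis th - z0))%C with (RtoC r * cis th)%C by ring. reflexivity.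
Qed.

End Cauchy.

(** * Taylor expansion *)

Lemma csum_S (a : nat -> C) (n : nat) : sum_n a (S n) = (sum_n a n + a (S n))%C.
Proof. exact (sum_Sn a n). Qed.

Lemma csum_0 (a : nat -> C) : sum_n a 0 = a O.
Proof. exact (sum_O a). Qed.

Lemma geometric_sum (q : C) (n : nat) : (sum_n (fun k => q ^ k) n * (1 - q) = 1 - q ^ S n)%C.
Proof.
  induction n as [|n IH].
  - rewrite csum_0. simpl. ring.
  - rewrite csum_S, Cmult_plus_distr_r, IH, !Cpow_S. ring.
Qed.

Lemma RC_continuous_on_circle (f : C -> C) (r th : R) :
  analytic_on_disk f -> 0 < r < 1 -> RCcontinuous (fun th => f (RtoC r * cis th)%C) th.
Proof.
  intros Hf Hr. apply (RC_continuous_comp f (fun th => (RtoC r * cis th)%C)).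
  - apply RC_continuous_mult; [apply RC_continuous_const|].
    apply (continuous_ext (fun t => cis (1 * t))). { intros s. f_equal. ring. }
    apply RC_continuous_cis.
  - apply Hf. unfold in_disk. rewrite Cmod_mult, Cmod_R, Cmod_cis, Rabs_pos_eq; lra.
Qed.

(** The radius is a parameter: each estimate below works inside a single disk
    [|z| < r], for one value of [r]. *)
Definition taylor_coef (f : C -> C) (r : R) (n : nat) : C :=
  (/ RtoC (2 * PI) * CInt (fun th => f (RtoC r * cis th) * (cis (- th) / RtoC r) ^ n) 0 (2 * PI))%C.

(** Replacing Cauchy's kernel by its geometric partial sum produces the partial
    sum of the Taylor series. *)
Lemma taylor_partial_sum (f : C -> C) (r : R) (z : C) (n : nat) :
  analytic_on_disk f -> 0 < r < 1 ->
  is_CRInt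
    (fun th => ((f (RtoC r * cis th) - f z) * sum_n (fun k => cauchy_ratio z r th ^ k) n)%C)
    0 (2 * PI)
    (RtoC (2 * PI) * (sum_n (fun k => taylor_coef f r k * z ^ k) n - f z))%C.
Proof.
  intros Hf Hr. pose proof PI_RGT_0 as HPI.
  assert (H2PI : RtoC (2 * PI) <> 0%C) by (apply RtoC_neq_0; lra).
  assert (Hr0 : RtoC r <> 0%C) by (apply RtoC_neq_0; lra).
  assert (Hk : forall k, is_CRInt
     (fun th => (f (RtoC r * cis th) * cauchy_ratio z r th ^ k)%C) 0 (2 * PI)
     (RtoC (2 * PI) * (taylor_coef f r k * z ^ k))%C).
  { intros k. unfold taylor_coef.
    replace (RtoC (2 * PI) * (/ RtoC (2 * PI) * CInt (fun th => (f (RtoC r * cis th) * (cis (- th) / RtoC r) ^ k)%C) 0 (2 * PI) * z ^ k))%C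
      with (z ^ k * CInt (fun th => (f (RtoC r * cis th) * (cis (- th) / RtoC r) ^ k)%C) 0 (2 * PI))%C
      by (field; exact H2PI).
    apply (is_RInt_ext (V := C_R_NormedModule)
      (fun th => (z ^ k * (f (RtoC r * cis th) * (cis (- th) / RtoC r) ^ k))%C)).
    { intros th _. unfold cauchy_ratio.
      replace (z / RtoC r * cis (- th))%C with (z * (cis (- th) / RtoC r))%C by (field; exact Hr0).
      rewrite Cpow_mult_l. Cring. }
    apply is_RInt_Cmult, CInt_correct. intros th _.
    apply RC_continuous_mult; [now apply RC_continuous_on_circle|].
    apply (RC_continuous_pow (fun th => (cis (- th) / RtoC r)%C)).
    apply RC_continuous_mult; [|apply RC_continuous_const].
    apply (continuous_ext (fun t => cis (-1 * t))). { intros t. f_equal. ring. }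
    apply RC_continuous_cis. }
  induction n as [|n IH].
  - rewrite csum_0.
    replace (RtoC (2 * PI) * (taylor_coef f r 0 * z ^ 0 - f z))%C with
      (RtoC (2 * PI) * (taylor_coef f r 0 * z ^ 0) - RtoC (2 * PI - 0) * f z)%C
      by (rewrite Rminus_0_r; ring).
    apply (is_RInt_ext (V := C_R_NormedModule)
      (fun th => (f (RtoC r * cis th) * cauchy_ratio z r th ^ 0 - f z)%C)).
    { intros th _. rewrite csum_0. change (cauchy_ratio z r th ^ 0)%C with (RtoC 1). Cring. }
    apply is_RInt_Cminus; [apply Hk | apply CInt_const].
  - rewrite csum_S.
    apply (is_RInt_ext (V := C_R_NormedModule)
      (fun th => ((f (RtoC r * cis th) - f z) * sum_n (fun k => cauchy_ratio z r th ^ k) n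
         + (f (RtoC r * cis th) * cauchy_ratio z r th ^ S n
            - f z * ((z / RtoC r) ^ S n * cis (- th) ^ S n)))%C)).
    { intros th _. rewrite csum_S. unfold cauchy_ratio. rewrite Cpow_mult_l. Cring. }
    replace (RtoC (2 * PI) * (sum_n (fun k => taylor_coef f r k * z ^ k) n + taylor_coef f r (S n) * z ^ S n - f z))%C
      with (RtoC (2 * PI) * (sum_n (fun k => taylor_coef f r k * z ^ k) n - f z)
         + (RtoC (2 * PI) * (taylor_coef f r (S n) * z ^ S n) - f z * ((z / RtoC r) ^ S n * RtoC 0)))%C by ring.
    apply is_RInt_Cplus; [exact IH|].
    apply is_RInt_Cminus; [apply Hk|].
    apply is_RInt_Cmult, is_RInt_Cmult, is_RInt_cis_pow. lia.
Qed.

(** The error is [O((|z| / r)^n)], from the remainder of the geometric series under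
    the integral in Cauchy's formula. *)
Lemma taylor_expansion (f : C -> C) (r : R) (z : C) :
  analytic_on_disk f -> 0 < r < 1 -> Cmod z < r ->
  is_Cseries (fun n => taylor_coef f r n * z ^ n)%C (f z).
Proof.
  intros Hf Hr Hz. pose proof PI_RGT_0 as HPI.
  assert (Hrho : Cmod z / r < 1) by (apply Rlt_div_l; lra).
  assert (Hrho0 : 0 <= Cmod z / r).
  { apply Rmult_le_pos; [apply Cmod_ge_0|]. left; apply Rinv_0_lt_compat; lra. }
  set (rho := Cmod z / r) in *.
  destruct (bounded_continuity (K := R_AbsRing) (V := C_R_NormedModule) (fun th => (f (RtoC r * cis th) - f z)%C) 0 (2 * PI)) as [M HM].
  { intros th _. apply RC_continuous_minus; [now apply RC_continuous_on_circle | apply RC_continuous_const]. }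
  assert (HM' : forall th, 0 <= th <= 2 * PI -> Cmod (f (RtoC r * cis th) - f z)%C <= M).
  { intros th Hth. left. rewrite <- norm_C_R. now apply HM. }
  assert (HM0 : 0 <= M).
  { eapply Rle_trans; [apply Cmod_ge_0|apply (HM' 0); lra]. }
  set (K := / (1 - rho)). assert (HK : 0 < K) by (apply Rinv_0_lt_compat; lra).
  assert (Hest : forall n, Cmod (sum_n (fun k => taylor_coef f r k * z ^ k)%C n - f z) <= M * K * rho ^ S n).
  { intros n.
    pose proof (is_RInt_Cminus _ _ _ _ _ _ (taylor_partial_sum f r z n Hf Hr)
      (cauchy_kernel f r z Hf Hr Hz)) as HI.
    eapply CInt_bound with (M := M * (K * rho ^ S n)) in HI; [|lra|].
    - set (w := (sum_n (fun k => taylor_coef f r k * z ^ k)%C n - f z)%C) in *.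
      replace (RtoC (2 * PI) * w - RtoC 0)%C with (RtoC (2 * PI) * w)%C in HI by ring.
      rewrite Cmod_mult, Cmod_R, Rabs_pos_eq, Rminus_0_r in HI by lra.
      apply Rmult_le_reg_l in HI; lra.
    - intros th Hth.
      destruct (one_minus_bound (cauchy_ratio z r th) rho) as [Hne Hinv].
      { rewrite Cmod_cauchy_ratio by lra. unfold rho; lra. } { exact Hrho. }
      replace ((f (RtoC r * cis th) - f z) * sum_n (fun k => cauchy_ratio z r th ^ k) n
        - (f (RtoC r * cis th) - f z) * / (1 - cauchy_ratio z r th))%C
        with (- ((f (RtoC r * cis th) - f z) * (/ (1 - cauchy_ratio z r th) * cauchy_ratio z r th ^ S n)))%C.
      + rewrite Cmod_opp, !Cmod_mult, Cmod_pow, Cmod_cauchy_ratio by lra. fold rho.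
        apply Rmult_le_compat; auto using Cmod_ge_0.
        * apply Rmult_le_pos; [apply Cmod_ge_0|]. now apply pow_le.
        * apply Rmult_le_compat_r; [now apply pow_le | exact Hinv].
      + replace (sum_n (fun k => cauchy_ratio z r th ^ k)%C n) with
          ((1 - cauchy_ratio z r th ^ S n) * / (1 - cauchy_ratio z r th))%C.
        * ring.
        * rewrite <- geometric_sum. field. exact Hne. }
  apply C_series_eps. intros eps Heps.
  destruct (pow_lt_1_zero rho) with (y := eps / (M * K + 1)) as [N HN].
  { rewrite Rabs_pos_eq; lra. }
  { apply Rdiv_lt_0_compat; nra. }
  exists N. intros n Hn. eapply Rle_lt_trans. apply Hest.
  specialize (HN (S n) ltac:(lia)).
  rewrite Rabs_pos_eq in HN by (now apply pow_le).
  assert (HMK : 0 <= M * K) by nra.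
  assert (E : eps / (M * K + 1) * (M * K + 1) = eps) by (field; lra).
  pose proof (pow_le rho (S n) Hrho0). nra.
Qed.

(** * Calculus of complex power series *)

Lemma is_Cseries_plus (a b : nat -> C) (l m : C) :
  is_Cseries a l -> is_Cseries b m -> is_Cseries (fun n => a n + b n)%C (l + m)%C.
Proof. intros. now apply (is_series_plus (V := C_NormedModule)). Qed.

Lemma is_Cseries_mult (c : C) (a : nat -> C) (l : C) :
  is_Cseries a l -> is_Cseries (fun n => c * a n)%C (c * l)%C.
Proof. intros. now apply (is_series_scal_l (K := C_AbsRing) (V := C_NormedModule)). Qed.

Lemma is_Cseries_minus (a b : nat -> C) (l m : C) :
  is_Cseries a l -> is_Cseries b m -> is_Cseries (fun n => a n - b n)%C (l - m)%C.
Proof. intros. now apply (is_series_minus (V := C_NormedModule)). Qed.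

Lemma is_Cseries_tail (a : nat -> C) (l : C) :
  is_Cseries a l <-> is_Cseries (fun n => a (S n)) (l - a O)%C.
Proof.
  split; intros H.
  - apply (is_series_incr_1 (V := C_NormedModule)).
    match goal with |- is_series _ ?w => replace w with l; [exact H|change (l = (l - a O + a O)%C); ring] end.
  - apply (is_series_decr_1 (V := C_NormedModule)). exact H.
Qed.

Lemma rsum_S (a : nat -> R) (n : nat) : sum_n a (S n) = sum_n a n + a (S n).
Proof. exact (sum_Sn a n). Qed.

Lemma rsum_0 (a : nat -> R) : sum_n a 0 = a O.
Proof. exact (sum_O a). Qed.

Lemma Cmod_sum_le (a : nat -> C) (b : nat -> R) :
  (forall n, Cmod (a n) <= b n) -> forall n, Cmod (sum_n a n) <= sum_n b n.
Proof.
  intros H. induction n as [|n IH].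
  - rewrite csum_0, sum_O. apply H.
  - rewrite csum_S, sum_Sn. eapply Rle_trans. apply Cmod_triangle.
    apply Rplus_le_compat; auto.
Qed.

Lemma Cmod_series_bounded (a : nat -> C) (l : C) (B : R) :
  (forall n, Cmod (sum_n a n) <= B) -> is_Cseries a l -> Cmod l <= B.
Proof.
  intros HB Ha.
  apply (is_lim_seq_le (fun n => Cmod (sum_n a n)) (fun _ => B) (Cmod l) B).
  - exact HB.
  - exact (filterlim_comp _ _ _ _ _ _ _ _ Ha (filterlim_norm (V := C_NormedModule) l)).
  - apply is_lim_seq_const.
Qed.

Lemma Cmod_series_le (a : nat -> C) (b : nat -> R) (l : C) (s : R) :
  (forall n, Cmod (a n) <= b n) -> is_Cseries a l -> is_series b s -> Cmod l <= s.
Proof.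
  intros Hab Ha Hb.
  apply (is_lim_seq_le (fun n => Cmod (sum_n a n)) (sum_n b) (Cmod l) s).
  - apply Cmod_sum_le, Hab.
  - exact (filterlim_comp _ _ _ _ _ _ _ _ Ha (filterlim_norm (V := C_NormedModule) l)).
  - exact Hb.
Qed.

Lemma Cmod_series_remainder (a : nat -> C) (b : nat -> R) (l : C) (s : R) (N : nat) :
  (forall n, Cmod (a n) <= b n) -> is_Cseries a l -> is_series b s ->
  Cmod (l - sum_n a N) <= s - sum_n b N.
Proof.
  intros Hab Ha Hb.
  apply (Cmod_series_le (fun n => a (S N + n)%nat) (fun n => b (S N + n)%nat)).
  - intros n. apply Hab.
  - apply (is_series_incr_n (V := C_NormedModule)); [lia|]. simpl pred.
    match goal with |- is_series _ ?w => replace w with l; [exact Ha|change (l = (l - sum_n a N + sum_n a N)%C); ring] end.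
  - apply (is_series_incr_n (V := R_NormedModule)); [lia|]. simpl pred.
    match goal with |- is_series _ ?w => replace w with s; [exact Hb|change (s = s - sum_n b N + sum_n b N); ring] end.
Qed.

Definition has_power_series (f : C -> C) (r : R) (c : nat -> C) : Prop :=
  forall z, Cmod z < r -> is_Cseries (fun n => c n * z ^ n)%C (f z).

Lemma power_series_at_0 (f : C -> C) (r : R) (c : nat -> C) :
  0 < r -> has_power_series f r c -> f (RtoC 0) = c O.
Proof.
  intros Hr Hc. specialize (Hc (RtoC 0) ltac:(rewrite Cmod_0; exact Hr)).
  apply (proj1 (is_Cseries_tail _ _)) in Hc. cbv beta in Hc.
  assert (H : Cmod (f (RtoC 0) - c O * RtoC 0 ^ 0)%C <= 0).
  { apply (Cmod_series_bounded _ _ _) with (2 := Hc).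
    induction n as [|n IH].
    - rewrite csum_0, Cpow_S, Cmult_0_l, Cmult_0_r, Cmod_0. lra.
    - rewrite csum_S, Cpow_S, Cmult_0_l, Cmult_0_r, Cplus_0_r. exact IH. }
  assert (E : (f (RtoC 0) - c O * RtoC 0 ^ 0)%C = 0%C).
  { apply Cmod_eq_0. apply Rle_antisym; [exact H | apply Cmod_ge_0]. }
  transitivity (f (RtoC 0) - c O * RtoC 0 ^ 0 + c O)%C; [simpl; ring|]. rewrite E. ring.
Qed.

(** Second-order Taylor bound for a power, by induction from
    [E(n+1) = y E(n) + n z^(n-1) (y - z)^2].  The constant is chosen so that summing
    it against the coefficients gives the twice differentiated series at [rho]. *)
Lemma power_remainder (rho : R) (y z : C) (n : nat) :
  Cmod y <= rho -> Cmod z <= rho ->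
  Cmod (y ^ S (S n) - z ^ S (S n) - (y - z) * (RtoC (INR (S (S n))) * z ^ S n))
    <= INR (S (S n)) * INR (S n) * rho ^ n * Cmod (y - z) ^ 2.
Proof.
  intros Hy Hz. assert (Hrho : 0 <= rho) by (eapply Rle_trans; [apply Cmod_ge_0 | exact Hy]).
  induction n as [|n IH].
  - replace (y ^ 2 - z ^ 2 - (y - z) * (RtoC (INR 2) * z ^ 1))%C with ((y - z) ^ 2)%C
      by (simpl INR; rewrite RtoC_plus; ring).
    rewrite Cmod_pow. pose proof (pow2_ge_0 (Cmod (y - z))). simpl INR. simpl (rho ^ 0). nra.
  - set (E := (y ^ S (S n) - z ^ S (S n) - (y - z) * (RtoC (INR (S (S n))) * z ^ S n))%C) in *.
    replace (y ^ S (S (S n)) - z ^ S (S (S n)) - (y - z) * (RtoC (INR (S (S (S n)))) * z ^ S (S n)))%C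
      with (y * E + RtoC (INR (S (S n))) * z ^ S n * (y - z) ^ 2)%C
      by (unfold E; rewrite (S_INR (S (S n))), RtoC_plus, !Cpow_S; ring).
    eapply Rle_trans. apply Cmod_triangle.
    rewrite !Cmod_mult, !Cmod_pow, Cmod_R, Rabs_pos_eq by apply pos_INR.
    pose proof (Cmod_ge_0 y). pose proof (Cmod_ge_0 z). pose proof (Cmod_ge_0 E).
    set (d := Cmod (y - z)) in *. assert (Hd : 0 <= d ^ 2) by apply pow2_ge_0.
    assert (Hzn : Cmod z ^ S n <= rho ^ S n) by (apply pow_incr; lra).
    assert (Hn : 0 <= INR n) by apply pos_INR.
    apply Rle_trans with (rho * (INR (S (S n)) * INR (S n) * rho ^ n * d ^ 2) + INR (S (S n)) * rho ^ S n * d ^ 2).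
    + apply Rplus_le_compat.
      * apply Rmult_le_compat; auto.
      * apply Rmult_le_compat_r; [exact Hd|]. apply Rmult_le_compat_l; [apply pos_INR | exact Hzn].
    + assert (Hp : 0 <= rho ^ S n * d ^ 2) by (apply Rmult_le_pos; [now apply pow_le | exact Hd]).
      rewrite !S_INR in *. simpl (rho ^ S n) in *.
      set (w := rho * rho ^ n * d ^ 2) in *.
      replace (rho * ((INR n + 1 + 1) * (INR n + 1) * rho ^ n * d ^ 2) + (INR n + 1 + 1) * (rho * rho ^ n) * d ^ 2)
        with ((INR n + 2) * (INR n + 2) * w) by (unfold w; ring).
      replace ((INR n + 1 + 1 + 1) * (INR n + 1 + 1) * (rho * rho ^ n) * d ^ 2)
        with ((INR n + 3) * (INR n + 2) * w) by (unfold w; ring).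
      nra.
Qed.

Section PowerSeries.

Variables (f : C -> C) (r : R) (c : nat -> C).
Hypothesis hc : has_power_series f r c.

Lemma coef_bounded (rho : R) : 0 <= rho < r -> exists K, forall n, Cmod (c n) * rho ^ n <= K.
Proof.
  intros Hrho.
  assert (H : is_Cseries (fun n => c n * RtoC rho ^ n)%C (f (RtoC rho))).
  { apply hc. rewrite Cmod_R, Rabs_pos_eq; lra. }
  destruct (filterlim_bounded (K := C_AbsRing) (V := C_NormedModule) (sum_n (fun n => c n * RtoC rho ^ n)%C)) as [K HK].
  { now exists (f (RtoC rho)). }
  exists (K + K). intros n.
  replace (Cmod (c n) * rho ^ n) with (Cmod (c n * RtoC rho ^ n)%C)
    by (now rewrite Cmod_mult, Cmod_pow, Cmod_R, Rabs_pos_eq by lra).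
  assert (HK' : forall n, Cmod (sum_n (fun n => c n * RtoC rho ^ n)%C n) <= K) by exact HK.
  assert (HK0 : 0 <= K) by (eapply Rle_trans; [apply Cmod_ge_0 | apply (HK' O)]).
  destruct n as [|n].
  - specialize (HK' O). rewrite csum_0 in HK'. lra.
  - pose proof (HK' (S n)) as A. rewrite csum_S in A.
    set (w := sum_n (fun n => c n * RtoC rho ^ n)%C n) in *.
    pose proof (Cmod_minus_triangle (w + c (S n) * RtoC rho ^ S n) w) as T.
    replace (w + c (S n) * RtoC rho ^ S n - w)%C with (c (S n) * RtoC rho ^ S n)%C in T by ring.
    specialize (HK' n). fold w in HK'. lra.
Qed.

(** Reduces absolute convergence to the radius of convergence of the real series of
    moduli, and this radius is unchanged by differentiation. *)
Lemma coef_radius (rho : R) : 0 <= rho < r -> Rbar_lt (Rabs rho) (CV_radius (fun n => Cmod (c n))).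
Proof.
  intros Hrho. set (rho' := (rho + r) / 2).
  destruct (coef_bounded rho') as [K HK]; [unfold rho'; lra|].
  apply Rbar_lt_le_trans with rho'.
  - rewrite Rabs_pos_eq by lra. simpl. unfold rho'. lra.
  - apply (CV_radius_bounded (fun n => Cmod (c n))). exists K. intros n.
    rewrite Rabs_pos_eq; [apply HK|].
    apply Rmult_le_pos; [apply Cmod_ge_0 | apply pow_le; unfold rho'; lra].
Qed.

(** Differentiation term by term: the error of the first-order expansion is bounded
    by [|y - z|^2] times a convergent series independent of [y]. *)
Lemma power_series_derive (z : C) : Cmod z < r -> exists l,
  is_Cderive f z l /\ is_Cseries (fun n => RtoC (INR (S n)) * c (S n) * z ^ n)%C l.
Proof.
  intros Hz. pose proof (Cmod_ge_0 z) as Hz0.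
  assert (Hex : exists l : C, is_Cseries (fun n => RtoC (INR (S n)) * c (S n) * z ^ n)%C l).
  { apply (ex_series_le (K := C_AbsRing) (V := C_CompleteNormedModule) _
      (fun n => Rabs (PS_derive (fun n => Cmod (c n)) n * Cmod z ^ n))).
    - intros n. change (Cmod (RtoC (INR (S n)) * c (S n) * z ^ n)%C <= Rabs (PS_derive (fun n => Cmod (c n)) n * Cmod z ^ n)).
      unfold PS_derive. rewrite !Cmod_mult, Cmod_R, Cmod_pow, !Rabs_mult.
      rewrite (Rabs_pos_eq (Cmod _)) by apply Cmod_ge_0.
      rewrite (Rabs_pos_eq (_ ^ n)) by (apply pow_le, Cmod_ge_0). lra.
    - apply CV_disk_inside. rewrite CV_radius_derive. apply coef_radius. lra. }
  destruct Hex as [l Hl]. exists l. split; [|exact Hl].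
  set (rho := (Cmod z + r) / 2). assert (Hrho : Cmod z < rho < r) by (unfold rho; lra).
  set (b := fun n => INR (S (S n)) * INR (S n) * Cmod (c (S (S n))) * rho ^ n).
  assert (Hb : ex_series b).
  { apply ex_series_Rabs.
    apply ex_series_ext with (a := fun n => Rabs (PS_derive (PS_derive (fun n => Cmod (c n))) n * rho ^ n)).
    - intros n. f_equal. unfold PS_derive, b. ring.
    - apply CV_disk_inside. rewrite !CV_radius_derive. apply coef_radius. lra. }
  destruct Hb as [B HB].
  assert (HB0 : 0 <= B).
  { assert (T : Cmod 0%C <= B); [|now rewrite Cmod_0 in T].
    apply (Cmod_series_le (fun _ => RtoC 0) b); [| |exact HB].
    - intros n. rewrite Cmod_0. unfold b.
      repeat apply Rmult_le_pos; try apply pos_INR; [apply Cmod_ge_0 | apply pow_le; lra].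
    - apply C_series_eps. intros eps Heps. exists O. intros n _.
      replace (sum_n (fun _ : nat => RtoC 0) n) with (RtoC 0).
      + unfold Cminus. rewrite Cplus_opp_r, Cmod_0. exact Heps.
      + induction n as [|n IH]; [now rewrite csum_0 | rewrite csum_S, <- IH; ring]. }
  assert (Hquad : forall y, Cmod (y - z) < rho - Cmod z ->
     Cmod (f y - f z - (y - z) * l)%C <= Cmod (y - z) ^ 2 * B).
  { intros y Hy.
    assert (Hyr : Cmod y < rho).
    { replace y with ((y - z) + z)%C by ring. eapply Rle_lt_trans. apply Cmod_triangle. lra. }
    (* The terms of index 0 and 1 vanish, so two shifts lose nothing. *)
    set (e := fun n => (c n * y ^ n - c n * z ^ n - (y - z) * (RtoC (INR n) * c n * z ^ pred n))%C).
    assert (He : is_Cseries e (f y - f z - (y - z) * l)%C).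
    { apply is_Cseries_minus; [apply is_Cseries_minus; apply hc; lra|].
      apply is_Cseries_mult. apply (proj2 (is_Cseries_tail _ _)). simpl pred.
      replace (l - RtoC (INR 0) * c 0%nat * z ^ 0)%C with l by (simpl INR; ring).
      exact Hl. }
    apply (proj1 (is_Cseries_tail _ _)) in He. apply (proj1 (is_Cseries_tail _ _)) in He. cbv beta in He.
    replace (f y - f z - (y - z) * l - e 0%nat - e 1%nat)%C with (f y - f z - (y - z) * l)%C in He
      by (unfold e; simpl; ring).
    apply (Cmod_series_le _ (fun n => Cmod (y - z) ^ 2 * b n) _ _) with (2 := He).
    - intros n. unfold e. simpl pred.
      replace (c (S (S n)) * y ^ S (S n) - c (S (S n)) * z ^ S (S n) - (y - z) * (RtoC (INR (S (S n))) * c (S (S n)) * z ^ S n))%C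
        with (c (S (S n)) * (y ^ S (S n) - z ^ S (S n) - (y - z) * (RtoC (INR (S (S n))) * z ^ S n)))%C by ring.
      rewrite Cmod_mult.
      pose proof (power_remainder rho y z n ltac:(lra) ltac:(lra)) as T.
      apply Rmult_le_compat_l with (r := Cmod (c (S (S n)))) in T; [|apply Cmod_ge_0].
      eapply Rle_trans; [exact T|]. unfold b. apply Req_le. ring.
    - apply (is_series_scal_l (K := R_AbsRing) (V := R_NormedModule)), HB. }
  apply C_derive_eps. intros eps Heps.
  exists (Rmin (rho - Cmod z) (eps / (B + 1))). split.
  { apply Rmin_pos; [lra|]. apply Rdiv_lt_0_compat; lra. }
  intros y Hy. eapply Rle_trans.
  - apply Hquad. eapply Rlt_le_trans; [exact Hy | apply Rmin_l].
  - assert (Hy2 : Cmod (y - z) < eps / (B + 1)) by (eapply Rlt_le_trans; [exact Hy | apply Rmin_r]).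
    pose proof (Cmod_ge_0 (y - z)) as Hd. set (d := Cmod (y - z)) in *.
    assert (E : eps / (B + 1) * (B + 1) = eps) by (field; lra).
    assert (d * (B + 1) <= eps) by (rewrite <- E; apply Rmult_le_compat_r; lra).
    replace (d ^ 2 * B) with (d * (d * B)) by ring. rewrite (Rmult_comm eps).
    apply Rmult_le_compat_l; lra.
Qed.

Lemma has_power_series_derive :
  has_power_series (C_derive f) r (fun n => RtoC (INR (S n)) * c (S n))%C.
Proof.
  intros z Hz. destruct (power_series_derive z Hz) as [l [H1 H2]].
  now rewrite (is_C_derive_unique f z l H1).
Qed.

End PowerSeries.

(** Accounts for the factors [z], [z^2], [z^3] in the Euler operator. *)
Lemma is_Cseries_shift (a : nat -> C) (z s : C) :
  a O = 0%C -> is_Cseries (fun n => a (S n) * z ^ n)%C s ->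
  is_Cseries (fun n => a n * z ^ n)%C (z * s)%C.
Proof.
  intros H0 H. apply (proj2 (is_Cseries_tail _ _)). rewrite H0.
  replace (z * s - 0 * z ^ 0)%C with (z * s)%C by ring.
  apply (is_series_ext (V := C_NormedModule) (fun n => z * (a (S n) * z ^ n))%C).
  - intros n. rewrite Cpow_S. Cring.
  - now apply is_Cseries_mult.
Qed.

(** The eigenvalue of the third-order Euler operator on [z^n]. *)
Definition multiplier (g1 g2 g3 : R) (n : nat) : R :=
  1 + g1 * INR n + g2 * (INR n * (INR n - 1)) + g3 * (INR n * (INR n - 1) * (INR n - 2)).

Lemma euler_operator_power_series (g1 g2 g3 r : R) (p : C -> C) (c : nat -> C) :
  has_power_series p r c ->
  has_power_series (fun z : C =>
       p z + RtoC g1 * z * C_derive p z + RtoC g2 * z ^ 2 * C_derive (C_derive p) z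
       + RtoC g3 * z ^ 3 * C_derive (C_derive (C_derive p)) z)%C
    r (fun n => RtoC (multiplier g1 g2 g3 n) * c n)%C.
Proof.
  intros H0 z Hz.
  pose proof (has_power_series_derive _ _ _ H0) as H1.
  pose proof (has_power_series_derive _ _ _ H1) as H2.
  pose proof (has_power_series_derive _ _ _ H2) as H3.
  set (d1 := C_derive p) in *. set (d2 := C_derive d1) in *. set (d3 := C_derive d2) in *.
  specialize (H0 z Hz). specialize (H1 z Hz). specialize (H2 z Hz). specialize (H3 z Hz).
  cbv beta in H1, H2, H3.
  assert (T1 : is_Cseries (fun n => RtoC (INR n) * c n * z ^ n)%C (z * d1 z)%C).
  { apply (is_Cseries_shift (fun n => RtoC (INR n) * c n)%C); [simpl; ring | exact H1]. }
  assert (T2 : is_Cseries (fun n => RtoC (INR n * (INR n - 1)) * c n * z ^ n)%C (z * (z * d2 z))%C).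
  { apply (is_Cseries_shift (fun n => RtoC (INR n * (INR n - 1)) * c n)%C).
    { simpl INR. rewrite Rmult_0_l. ring. }
    apply (is_Cseries_shift (fun n => RtoC (INR (S n) * (INR (S n) - 1)) * c (S n))%C).
    { simpl INR. rewrite Rminus_diag, Rmult_0_r. ring. }
    revert H2. apply (is_series_ext (V := C_NormedModule)). intros n.
    rewrite !S_INR, !RtoC_mult, !RtoC_minus, !RtoC_plus. Cring. }
  assert (T3 : is_Cseries (fun n => RtoC (INR n * (INR n - 1) * (INR n - 2)) * c n * z ^ n)%C (z * (z * (z * d3 z)))%C).
  { apply (is_Cseries_shift (fun n => RtoC (INR n * (INR n - 1) * (INR n - 2)) * c n)%C).
    { simpl INR. rewrite !Rmult_0_l. ring. }
    apply (is_Cseries_shift (fun n => RtoC (INR (S n) * (INR (S n) - 1) * (INR (S n) - 2)) * c (S n))%C).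
    { simpl INR. rewrite Rminus_diag, Rmult_0_r, Rmult_0_l. ring. }
    apply (is_Cseries_shift (fun n => RtoC (INR (S (S n)) * (INR (S (S n)) - 1) * (INR (S (S n)) - 2)) * c (S (S n)))%C).
    { simpl INR. replace (1 + 1 - 2) with 0 by ring. rewrite Rmult_0_r. ring. }
    revert H3. apply (is_series_ext (V := C_NormedModule)). intros n.
    rewrite !S_INR, !RtoC_mult, !RtoC_minus, !RtoC_plus. Cring. }
  apply (is_Cseries_mult (RtoC g1)) in T1. apply (is_Cseries_mult (RtoC g2)) in T2.
  apply (is_Cseries_mult (RtoC g3)) in T3.
  pose proof (is_Cseries_plus _ _ _ _ (is_Cseries_plus _ _ _ _ (is_Cseries_plus _ _ _ _ H0 T1) T2) T3) as T.
  replace (p z + RtoC g1 * z * d1 z + RtoC g2 * z ^ 2 * d2 z + RtoC g3 * z ^ 3 * d3 z)%C with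
    (p z + RtoC g1 * (z * d1 z) + RtoC g2 * (z * (z * d2 z)) + RtoC g3 * (z * (z * (z * d3 z))))%C by ring.
  revert T. apply (is_series_ext (V := C_NormedModule)). intros n.
  unfold multiplier. rewrite !RtoC_plus, !RtoC_mult. Cring.
Qed.

(** * Bessel's inequality *)

Definition circle_sum (c : nat -> C) (r : R) (N : nat) (th : R) : C :=
  sum_n (fun k => c k * (RtoC r * cis th) ^ k)%C N.

Lemma circle_sum_orthogonal (c : nat -> C) (r : R) (N m : nat) : (N < m)%nat ->
  is_CRInt (fun th => circle_sum c r N th * cis (- th) ^ m)%C 0 (2 * PI) (RtoC 0).
Proof.
  assert (Hk : forall k, (k < m)%nat -> is_CRInt
     (fun th => c k * (RtoC r * cis th) ^ k * cis (- th) ^ m)%C 0 (2 * PI) (RtoC 0)).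
  { intros k Hkm. replace (RtoC 0) with (c k * RtoC r ^ k * RtoC 0)%C by ring.
    apply (is_RInt_ext (V := C_R_NormedModule) (fun th => c k * RtoC r ^ k * cis (- th) ^ (m - k))%C).
    - intros th _. rewrite Cpow_mult_l, <- (cis_cancel th k m) by lia. Cring.
    - apply is_RInt_Cmult, is_RInt_cis_pow. lia. }
  induction N as [|N IH]; intros HN.
  - apply (is_RInt_ext (V := C_R_NormedModule) (fun th => c O * (RtoC r * cis th) ^ 0 * cis (- th) ^ m)%C).
    + intros th _. unfold circle_sum. now rewrite csum_0.
    + apply Hk. lia.
  - apply (is_RInt_ext (V := C_R_NormedModule) (fun th =>
      circle_sum c r N th * cis (- th) ^ m + c (S N) * (RtoC r * cis th) ^ S N * cis (- th) ^ m)%C).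
    + intros th _. unfold circle_sum. rewrite csum_S. Cring.
    + replace (RtoC 0) with (RtoC 0 + RtoC 0)%C by ring.
      apply is_RInt_Cplus; [apply IH | apply Hk]; lia.
Qed.

(** By induction on [N]: the new monomial is orthogonal to the partial sum. *)
Lemma circle_sum_parseval (c : nat -> C) (r : R) (N : nat) :
  is_CRInt (fun th => circle_sum c r N th * Cconj (circle_sum c r N th))%C 0 (2 * PI)
    (RtoC (2 * PI * sum_n (fun k => Cmod (c k) ^ 2 * r ^ (2 * k)) N)).
Proof.
  assert (Hterm : forall k th,
    (c k * (RtoC r * cis th) ^ k * Cconj (c k * (RtoC r * cis th) ^ k))%C
      = RtoC (Cmod (c k) ^ 2 * r ^ (2 * k))).
  { intros k th. rewrite <- Cmod2_conj, Cmod_mult, Cmod_pow, Cmod_mult, Cmod_cis, Cmod_R, Rmult_1_r.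
    f_equal. rewrite Rpow_mult_distr, <- pow_mult, Nat.mul_comm, pow_mult, pow2_abs, <- pow_mult. reflexivity. }
  induction N as [|N IH].
  - rewrite rsum_0. replace (2 * PI) with (2 * PI - 0) at 2 by ring. rewrite RtoC_mult.
    apply (is_RInt_ext (V := C_R_NormedModule) (fun _ => RtoC (Cmod (c O) ^ 2 * r ^ (2 * 0)))).
    + intros th _. unfold circle_sum. rewrite csum_0. symmetry. apply Hterm.
    + apply CInt_const.
  - rewrite rsum_S.
    pose (t := fun th => (c (S N) * (RtoC r * cis th) ^ S N)%C).
    assert (Hcross : is_CRInt (fun th => circle_sum c r N th * Cconj (t th))%C 0 (2 * PI) (RtoC 0)).
    { replace (RtoC 0) with (Cconj (c (S N)) * RtoC r ^ S N * RtoC 0)%C by ring.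
      apply (is_RInt_ext (V := C_R_NormedModule) (fun th =>
        Cconj (c (S N)) * RtoC r ^ S N * (circle_sum c r N th * cis (- th) ^ S N))%C).
      - intros th _. unfold t. rewrite Cmult_conj, Cpow_conj, Cmult_conj, cis_conj, Cpow_mult_l.
        replace (Cconj (RtoC r)) with (RtoC r) by (unfold Cconj, RtoC; simpl; f_equal; ring). Cring.
      - apply is_RInt_Cmult, circle_sum_orthogonal. lia. }
    pose proof (is_RInt_Cconj _ _ _ _ Hcross) as Hcross'.
    pose proof (CInt_const (RtoC (Cmod (c (S N)) ^ 2 * r ^ (2 * S N))) 0 (2 * PI)) as Hdiag.
    pose proof (is_RInt_Cplus _ _ _ _ _ _ (is_RInt_Cplus _ _ _ _ _ _ IH Hcross)
                 (is_RInt_Cplus _ _ _ _ _ _ Hcross' Hdiag)) as T.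
    match type of T with is_RInt _ _ _ ?w => match goal with |- is_RInt _ _ _ ?w' => replace w' with w end end.
    + revert T. apply (is_RInt_ext (V := C_R_NormedModule)).
      intros th _. rewrite <- (Hterm (S N) th). fold (t th).
      unfold circle_sum. rewrite csum_S. fold (circle_sum c r N th). fold (t th).
      rewrite Cmult_conj, Cconj_conj, Cplus_conj. Cring.
    + rewrite Rminus_0_r. 
      replace (Cconj (RtoC 0)) with (RtoC 0) by (unfold Cconj, RtoC; simpl; f_equal; ring).
      rewrite <- !RtoC_mult, <- !RtoC_plus. f_equal. simpl. ring.
Qed.

(** Parseval's identity is applied to partial sums, which are bounded by [M] up to an
    arbitrarily small uniform error on the circle. *)
Lemma bessel_bound (g : C -> C) (r rho M : R) (c : nat -> C) :
  has_power_series g r c -> 0 < rho < r -> (forall z, Cmod z < r -> Cmod (g z) <= M) ->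
  forall N, sum_n (fun k => Cmod (c k) ^ 2 * rho ^ (2 * k)) N <= M ^ 2.
Proof.
  intros Hc Hrho HM N. pose proof PI_RGT_0 as HPI.
  assert (HM0 : 0 <= M).
  { eapply Rle_trans; [apply Cmod_ge_0 | apply (HM (RtoC 0)); rewrite Cmod_0; lra]. }
  set (b := fun n => Cmod (c n) * rho ^ n).
  assert (Hb : ex_series b).
  { apply ex_series_Rabs. apply (CV_disk_inside (fun n => Cmod (c n))).
    apply (coef_radius g r c Hc). lra. }
  destruct Hb as [s Hs].
  set (u := sum_n (fun k => Cmod (c k) ^ 2 * rho ^ (2 * k))).
  assert (Humono : forall n k, u n <= u (n + k)%nat).
  { intros n k. induction k as [|k IH]; [rewrite Nat.add_0_r; lra|].
    rewrite Nat.add_succ_r. unfold u at 2. rewrite rsum_S. fold (u (n + k)%nat).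
    eapply Rle_trans; [exact IH|]. rewrite <- (Rplus_0_r (u (n + k)%nat)) at 1.
    apply Rplus_le_compat_l. apply Rmult_le_pos; [apply pow2_ge_0 | apply pow_le; lra]. }
  apply le_epsilon. intros e He.
  destruct (small_multiple e (2 * M + 1) He) as [eps [He1 He2]]; [lra|].
  destruct (proj1 (filterlim_locally_ball_norm (U := R_NormedModule) (F := eventually) (sum_n b) s) Hs (mkposreal eps (proj1 He1))) as [N0 HN0].
  set (n := (N + N0)%nat).
  assert (Hn : s - sum_n b n <= eps).
  { specialize (HN0 n ltac:(unfold n; lia)). hnf in HN0. simpl in HN0.
    change (Rabs (sum_n b n - s) < eps) in HN0. apply Rabs_def2 in HN0. lra. }
  eapply Rle_trans; [apply (Humono N N0)|]. fold n.
  pose proof (circle_sum_parseval c rho n) as T. fold u in T.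
  eapply CInt_bound with (M := (M + eps) ^ 2) in T; [|lra|].
  - assert (Hu0 : 0 <= u n).
    { apply Rle_trans with (u O); [|apply (Humono O n)]. unfold u. rewrite rsum_0.
      apply Rmult_le_pos; [apply pow2_ge_0 | apply pow_le; lra]. }
    rewrite Cmod_R, Rminus_0_r, Rabs_pos_eq in T by (apply Rmult_le_pos; lra).
    apply Rmult_le_reg_l in T; [|lra]. nra.
  - intros th _. rewrite Cmod_mult, Cmod_conj.
    assert (H : Cmod (circle_sum c rho n th) <= M + eps).
    { set (z := (RtoC rho * cis th)%C).
      assert (Hz : Cmod z = rho).
      { unfold z. rewrite Cmod_mult, Cmod_R, Cmod_cis, Rabs_pos_eq; lra. }
      assert (Hrem : Cmod (g z - circle_sum c rho n th) <= s - sum_n b n).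
      { apply Cmod_series_remainder; [|apply Hc; lra|exact Hs].
        intros k. unfold b. rewrite Cmod_mult, Cmod_pow. fold z. rewrite Hz. lra. }
      replace (circle_sum c rho n th) with (g z - (g z - circle_sum c rho n th))%C by ring.
      eapply Rle_trans; [apply Cmod_minus_triangle|].
      specialize (HM z ltac:(lra)). lra. }
    pose proof (Cmod_ge_0 (circle_sum c rho n th)). nra.
Qed.

(** * Distance from the solution to its constant term *)

Lemma sum_inv_squares (n : nat) : sum_n (fun k => / INR (S k) ^ 2) n <= 2 - / INR (S n).
Proof.
  induction n as [|n IH].
  - rewrite rsum_0. simpl. lra.
  - rewrite rsum_S. 
    assert (Hn : 0 < INR (S n)) by (apply lt_0_INR; lia).
    rewrite (S_INR (S n)). set (x := INR (S n)) in *.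
    assert (H : / (x + 1) ^ 2 <= / x - / (x + 1)).
    { replace (/ x - / (x + 1)) with (/ (x * (x + 1))) by (field; lra).
      apply Rinv_le_contravar; nra. }
    lra.
Qed.

Lemma multiplier_ge (g1 g2 g3 : R) (n : nat) : 0 <= g2 -> 0 <= g3 -> (0 < n)%nat ->
  g1 * INR n <= multiplier g1 g2 g3 n.
Proof.
  intros H2 H3 Hn. unfold multiplier.
  assert (A : 0 <= INR n * (INR n - 1) /\ 0 <= INR n * (INR n - 1) * (INR n - 2)).
  { destruct n as [|[|n]]; [lia|simpl; lra|].
    rewrite !S_INR. pose proof (pos_INR n). set (x := INR n) in *.
    replace (x + 1 + 1 - 1) with (x + 1) by ring. replace (x + 1 + 1 - 2) with x by ring.
    split; repeat apply Rmult_le_pos; lra. }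
  pose proof (Rmult_le_pos _ _ H2 (proj1 A)). pose proof (Rmult_le_pos _ _ H3 (proj2 A)). lra.
Qed.

(** The n-th coefficient [c_n] of [p] is at most [|b_n| / (g1 n)], where [b_n] is that
    of [L p - 1].  Bessel's inequality controls [sum |b_n|^2] by [M^2], and
    [sum 1/n^2 <= 2], so [sum |b_n| / n <= (M + 2 M) / 2].  The constant term of
    [p - 1] vanishes, whence the factor [|z| / rho]. *)
Lemma deviation_bound (g1 g2 g3 r rho M : R) (p : C -> C) (c : nat -> C) :
  0 < g1 -> 0 <= g2 -> 0 <= g3 -> 0 < rho < r -> 0 < M ->
  has_power_series p r c -> p (RtoC 0) = RtoC 1 ->
  (forall z, Cmod z < r -> Cmod (p z + RtoC g1 * z * C_derive p z
     + RtoC g2 * z ^ 2 * C_derive (C_derive p) z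
     + RtoC g3 * z ^ 3 * C_derive (C_derive (C_derive p)) z - 1)%C <= M) ->
  forall z, Cmod z <= rho -> Cmod (p z - 1)%C <= 3 * M / (2 * g1) * (Cmod z / rho).
Proof.
  intros H1 H2 H3 Hrho HM Hc Hp0 Hbound z Hz.
  assert (Hc0 : c O = RtoC 1).
  { rewrite <- Hp0. symmetry. apply (power_series_at_0 p r); [lra | exact Hc]. }
  set (d := fun n => (RtoC (multiplier g1 g2 g3 n) * c n)%C).
  (* [d] with its constant term, which is 1, removed: the coefficients of [L p - 1]. *)
  set (d' := fun n => match n with O => RtoC 0 | S _ => d n end).
  assert (Hd' : has_power_series (fun z => p z + RtoC g1 * z * C_derive p z
     + RtoC g2 * z ^ 2 * C_derive (C_derive p) z
     + RtoC g3 * z ^ 3 * C_derive (C_derive (C_derive p)) z - 1)%C r d').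
  { intros y Hy. pose proof (euler_operator_power_series g1 g2 g3 r p c Hc y Hy) as T.
    apply (proj1 (is_Cseries_tail _ _)) in T. cbv beta in T.
    apply (proj2 (is_Cseries_tail _ _)).
    match type of T with is_series _ ?w => match goal with |- is_series _ ?w' => replace w' with w end end.
    - exact T.
    - unfold multiplier, d'. rewrite Hc0. simpl INR. rewrite !Rmult_0_l, !Rmult_0_r, !Rplus_0_r.
      simpl. Cring. }
  pose proof (bessel_bound _ r rho M d' Hd' Hrho Hbound) as HB.
  assert (Hterm : forall n, Cmod (c (S n)) * rho ^ S n <=
    / (2 * g1) * (/ M * (Cmod (d' (S n)) ^ 2 * rho ^ (2 * S n)) + M * / INR (S n) ^ 2)).
  { intros n. assert (Hn : 0 < INR (S n)) by (apply lt_0_INR; lia).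
    assert (Hm : g1 * INR (S n) <= multiplier g1 g2 g3 (S n)) by (apply multiplier_ge; auto; lia).
    assert (Hm0 : 0 < g1 * INR (S n)) by nra.
    set (X := Cmod (d' (S n)) * rho ^ S n).
    assert (HX : Cmod (c (S n)) * rho ^ S n * (g1 * INR (S n)) <= X).
    { unfold X, d', d. rewrite Cmod_mult, Cmod_R, Rabs_pos_eq by lra.
      assert (0 <= Cmod (c (S n)) * rho ^ S n).
      { apply Rmult_le_pos; [apply Cmod_ge_0 | apply pow_le; lra]. }
      nra. }
    replace (Cmod (d' (S n)) ^ 2 * rho ^ (2 * S n)) with (X ^ 2)
      by (unfold X; rewrite Rpow_mult_distr, <- pow_mult; f_equal; f_equal; lia).
    apply Rle_trans with (X * / (g1 * INR (S n))).
    - apply (Rmult_le_reg_r (g1 * INR (S n))); [exact Hm0|].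
      rewrite (Rmult_assoc X), Rinv_l, Rmult_1_r by lra. exact HX.
    - set (x := INR (S n)) in *.
      (* Weighted arithmetic-geometric mean inequality between [X] and [1/x]. *)
      assert (Hsq : 0 <= / M * (X - M * / x) ^ 2).
      { apply Rmult_le_pos; [left; now apply Rinv_0_lt_compat | apply pow2_ge_0]. }
      replace (/ M * (X - M * / x) ^ 2) with (/ M * X ^ 2 + M * / x ^ 2 - 2 * (X * / x)) in Hsq by (field; lra).
      replace (X * / (g1 * x)) with (/ (2 * g1) * (2 * (X * / x))) by (field; lra).
      apply Rmult_le_compat_l; [left; apply Rinv_0_lt_compat; lra | lra]. }
  assert (Hsum : forall n, sum_n (fun k => Cmod (c (S k)) * rho ^ S k) n <= 3 * M / (2 * g1)).
  { intros n.
    apply Rle_trans with (/ (2 * g1) * (/ M * sum_n (fun k => Cmod (d' k) ^ 2 * rho ^ (2 * k)) (S n)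
       + M * sum_n (fun k => / INR (S k) ^ 2) n)).
    - clear HB. induction n as [|n IH].
      + rewrite rsum_S, !rsum_0.  eapply Rle_trans; [apply Hterm|].
        apply Req_le. unfold d' at 2. rewrite Cmod_0. simpl. ring.
      + rewrite (rsum_S _ (S n)), !(rsum_S _ n). 
        pose proof (Hterm (S n)) as T. rewrite (rsum_S _ n) in IH. 
        lra.
    - specialize (HB (S n)). pose proof (sum_inv_squares n) as HS.
      assert (0 < / INR (S n)) by (apply Rinv_0_lt_compat, lt_0_INR; lia).
      replace (3 * M / (2 * g1)) with (/ (2 * g1) * (/ M * M ^ 2 + M * 2)) by (field; lra).
      apply Rmult_le_compat_l; [left; apply Rinv_0_lt_compat; lra|].
      apply Rplus_le_compat.
      + apply Rmult_le_compat_l; [left; now apply Rinv_0_lt_compat | exact HB].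
      + apply Rmult_le_compat_l; lra. }
  specialize (Hc z ltac:(lra)). apply (proj1 (is_Cseries_tail _ _)) in Hc. cbv beta in Hc.
  replace (p z - 1)%C with (p z - c O * z ^ 0)%C by (rewrite Hc0; simpl; ring).
  apply (Cmod_series_bounded _ _ _) with (2 := Hc).
  intros n. pose proof (Cmod_ge_0 z) as Hz0.
  apply Rle_trans with (sum_n (fun k => Cmod z / rho * (Cmod (c (S k)) * rho ^ S k)) n).
  - apply Cmod_sum_le. intros k. rewrite Cmod_mult, Cmod_pow.
    replace (Cmod z / rho * (Cmod (c (S k)) * rho ^ S k)) with (Cmod (c (S k)) * (Cmod z * rho ^ k))
      by (simpl; field; lra).
    apply Rmult_le_compat_l; [apply Cmod_ge_0|]. simpl.
    apply Rmult_le_compat_l; [exact Hz0|]. apply pow_incr; lra.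
  - rewrite (sum_n_mult_l (K := R_AbsRing)). rewrite (Rmult_comm (3 * M / (2 * g1))).
    apply Rmult_le_compat_l; [|apply Hsum].
    apply Rmult_le_pos; [exact Hz0 | left; apply Rinv_0_lt_compat; lra].
Qed.

(** * A bound for the inverse hyperbolic sine *)

Lemma cis_Carg (u : C) : u <> 0%C -> (RtoC (Cmod u) * cis (Carg u))%C = u.
Proof.
  intros Hu. assert (Hm : 0 < Cmod u) by now apply Cmod_gt_0.
  assert (Hsq : Re u ^ 2 + Im u ^ 2 = Cmod u ^ 2) by (symmetry; apply Cmod2_alt).
  set (m := Cmod u) in *.
  assert (Hx : -1 <= Re u / m <= 1).
  { pose proof (re_le_Cmod u) as T. fold m in T. apply Rabs_le_between in T.
    split; [apply Rle_div_r | apply Rle_div_l]; lra. }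
  assert (Hs : sin (acos (Re u / m)) = Rabs (Im u) / m).
  { rewrite sin_acos by exact Hx. replace (1 - (Re u / m)²) with ((Im u / m)²).
    - rewrite sqrt_Rsqr_abs, Rabs_div, (Rabs_pos_eq m); lra.
    - unfold Rsqr. apply (Rmult_eq_reg_r (m ^ 2)); [|nra]. field_simplify; lra. }
  assert (Hc : cos (acos (Re u / m)) = Re u / m) by now apply cos_acos.
  unfold Carg. fold m. destruct u as [x y]. unfold cis, RtoC, Cmult, Re, Im in *. simpl in *.
  destruct (Rle_dec 0 y) as [Hy|Hy]; rewrite ?cos_neg, ?sin_neg, Hc, Hs.
  - rewrite Rabs_pos_eq by exact Hy. f_equal; field; lra.
  - rewrite Rabs_left by lra. f_equal; field; lra.
Qed.

Lemma Carg_bound (u : C) : Rabs (Carg u) <= PI.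
Proof.
  unfold Carg. pose proof (acos_bound (Re u / Cmod u)).
  destruct (Rle_dec 0 (Im u)); apply Rabs_le; lra.
Qed.

Lemma Csqrt_cis (u : C) : Csqrt u = (RtoC (sqrt (Cmod u)) * cis (Carg u / 2))%C.
Proof.
  unfold Csqrt, Cexp. f_equal.
  assert (E1 : Re (Ci * RtoC (Carg u / 2)) = 0) by (unfold Re, Ci, RtoC, Cmult; simpl; ring).
  assert (E2 : Im (Ci * RtoC (Carg u / 2)) = Carg u / 2) by (unfold Im, Ci, RtoC, Cmult; simpl; ring).
  rewrite E1, E2, exp_0. fold (cis (Carg u / 2)). ring.
Qed.

Lemma Cmod_Csqrt (u : C) : Cmod (Csqrt u) = sqrt (Cmod u).
Proof.
  rewrite Csqrt_cis, Cmod_mult, Cmod_cis, Cmod_R, Rabs_pos_eq by apply sqrt_pos. ring.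
Qed.

Lemma Csqrt_sqr (u : C) : (Csqrt u * Csqrt u)%C = u.
Proof.
  destruct (Req_dec (Cmod u) 0) as [H0|H0].
  - apply Cmod_eq_0 in H0. subst u.
    rewrite Csqrt_cis, Cmod_0, sqrt_0. ring.
  - assert (Hu : u <> 0%C). { intros E. apply H0. rewrite E. apply Cmod_0. }
    rewrite Csqrt_cis.
    replace (RtoC (sqrt (Cmod u)) * cis (Carg u / 2) * (RtoC (sqrt (Cmod u)) * cis (Carg u / 2)))%C
      with (RtoC (sqrt (Cmod u)) * RtoC (sqrt (Cmod u)) * (cis (Carg u / 2) * cis (Carg u / 2)))%C by ring.
    rewrite <- RtoC_mult, sqrt_sqrt by apply Cmod_ge_0.
    rewrite <- cis_plus. replace (Carg u / 2 + Carg u / 2) with (Carg u) by field.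
    now apply cis_Carg.
Qed.

Lemma ln_le_minus_1 (x : R) : 0 < x -> ln x <= x - 1.
Proof.
  intros Hx. pose proof (exp_ineq1_le (ln x)) as H. rewrite exp_ln in H by exact Hx. lra.
Qed.

(** From [ln y <= y - 1] for [y = x] and [y = 1 / x]. *)
Lemma Rabs_ln_le (x K : R) : 0 < x -> x <= 1 + K -> / x <= 1 + K -> Rabs (ln x) <= K.
Proof.
  intros Hx H1 H2. pose proof (ln_le_minus_1 x Hx).
  pose proof (ln_le_minus_1 (/ x) (Rinv_0_lt_compat x Hx)) as H'.
  rewrite ln_Rinv in H' by exact Hx. apply Rabs_le. lra.
Qed.

(** Seven terms of Leibniz's series; the standard bound [PI <= 4] would be too weak
    for the final numerical estimate. *)
Lemma PI_upper : PI <= 33 / 10.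
Proof.
  pose proof (proj2 (PI_ineq 3)) as H. simpl in H. unfold tg_alt, PI_tg in H. simpl in H. lra.
Qed.

(** The crude bound [|Arg| <= PI] for the imaginary part suffices.  For the real
    part, [z + s] and [s - z] are inverse to each other when [s^2 = 1 + z^2], and
    both have modulus at most [1 + sqrt 2]. *)
Lemma Carcsinh_bound (z : C) : Cmod z < 1 -> Cmod (Carcsinh z) <= 36 / 10.
Proof.
  intros Hz. unfold Carcsinh. pose proof (Cmod_ge_0 z) as Hz0.
  set (s := Csqrt (1 + z * z)).
  assert (Hs : Cmod s <= sqrt 2).
  { unfold s. rewrite Cmod_Csqrt. apply sqrt_le_1_alt.
    eapply Rle_trans; [apply Cmod_triangle|]. rewrite Cmod_1, Cmod_mult. nra. }
  assert (Hprod : ((z + s) * (s - z) = 1)%C).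
  { replace ((z + s) * (s - z))%C with (s * s - z * z)%C by ring.
    unfold s. rewrite Csqrt_sqr. ring. }
  assert (Hm : Cmod (z + s) * Cmod (s - z) = 1) by (rewrite <- Cmod_mult, Hprod; apply Cmod_1).
  pose proof (Cmod_triangle z s) as A1. pose proof (Cmod_minus_triangle s z) as A2.
  pose proof (Cmod_ge_0 (z + s)) as A3. pose proof (Cmod_ge_0 (s - z)) as A4.
  assert (Hpos : 0 < Cmod (z + s)) by nra.
  assert (Hinv : / Cmod (z + s) = Cmod (s - z)).
  { apply (Rmult_eq_reg_l (Cmod (z + s))); [|lra]. rewrite Hm. field. lra. }
  assert (Hln : Rabs (ln (Cmod (z + s))) <= sqrt 2) by (apply Rabs_ln_le; lra).
  pose proof (Carg_bound (z + s)) as Harg. pose proof PI_upper. pose proof PI_RGT_0.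
  assert (Q1 : ln (Cmod (z + s)) ^ 2 <= 2).
  { rewrite <- (pow2_abs (ln _)), <- (pow2_sqrt 2) by lra. apply pow_incr. split; [apply Rabs_pos | exact Hln]. }
  assert (Q2 : Carg (z + s) ^ 2 <= (33 / 10) ^ 2).
  { rewrite <- (pow2_abs (Carg _)). apply pow_incr. split; [apply Rabs_pos | lra]. }
  unfold Clog. apply Cmod_le_squares; lra.
Qed.

(** * Exponential, and logarithm on the right half-plane *)

Lemma Cexp_plus (a b : C) : Cexp (a + b) = (Cexp a * Cexp b)%C.
Proof.
  unfold Cexp.
  replace (Re (a + b)) with (Re a + Re b) by reflexivity.
  replace (Im (a + b)) with (Im a + Im b) by reflexivity.
  fold (cis (Im a + Im b)). rewrite cis_plus, exp_plus, RtoC_mult. unfold cis. ring.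
Qed.

(** By the functional equation it is enough to expand [exp a * cis b] at 0. *)
Lemma Cexp_derive (w : C) : is_Cderive Cexp w (Cexp w).
Proof.
  apply C_derive_eps. intros eps0 Heps0.
  pose proof (Cmod_ge_0 (Cexp w)) as HE.
  destruct (small_multiple eps0 (6 * Cmod (Cexp w))) as [eps [He1 He2]]; [exact Heps0 | lra |].
  destruct (R_derive_eps exp 0 (exp 0) (is_derive_exp 0) eps) as [d1 [P1 H1]]; [lra|].
  destruct (cis_derive_eps 0 eps) as [d2 [P2 H2]]; [lra|].
  exists (Rmin eps (Rmin d1 d2)). split; [repeat apply Rmin_pos; lra|].
  intros y Hy. set (h := (y - w)%C) in *.
  assert (Hy0 : Cmod h < eps) by (eapply Rlt_le_trans; [exact Hy | apply Rmin_l]).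
  assert (Hy1 : Cmod h < d1).
  { eapply Rlt_le_trans; [exact Hy|]. eapply Rle_trans; [apply Rmin_r | apply Rmin_l]. }
  assert (Hy2 : Cmod h < d2).
  { eapply Rlt_le_trans; [exact Hy|]. eapply Rle_trans; [apply Rmin_r | apply Rmin_r]. }
  replace y with (w + h)%C by (unfold h; ring). rewrite Cexp_plus.
  replace (Cexp w * Cexp h - Cexp w - h * Cexp w)%C with (Cexp w * (Cexp h - 1 - h))%C by ring.
  rewrite Cmod_mult.
  destruct (Rabs_Re_Im_le h) as [R1 R2]. set (a := Re h) in *. set (b := Im h) in *.
  specialize (H1 a). specialize (H2 b). rewrite exp_0, Rminus_0_r, Rmult_1_r in H1.
  rewrite cis_0, Rminus_0_r in H2. specialize (H1 ltac:(lra)). specialize (H2 ltac:(lra)).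
  assert (Hh : h = (RtoC a + Ci * RtoC b)%C).
  { unfold a, b, Re, Im, Ci, RtoC, Cplus, Cmult. destruct h; simpl. f_equal; ring. }
  assert (Ha : Cmod (RtoC (exp a - 1 - a)) <= eps * Cmod h).
  { rewrite Cmod_R. eapply Rle_trans; [exact H1|]. apply Rmult_le_compat_l; lra. }
  assert (Hb : Cmod (cis b - 1 - RtoC b * (Ci * 1)) <= eps * Cmod h).
  { eapply Rle_trans; [exact H2|]. apply Rmult_le_compat_l; lra. }
  assert (Hexp : Rabs (exp a - 1) <= 2 * Cmod h).
  { rewrite Cmod_R in Ha. replace (exp a - 1) with ((exp a - 1 - a) + a) by ring.
    eapply Rle_trans; [apply Rabs_triang|]. pose proof (Cmod_ge_0 h). nra. }
  assert (Hcore : Cmod (Cexp h - 1 - h) <= 6 * eps * Cmod h).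
  { unfold Cexp. fold a b. fold (cis b).
    replace (RtoC (exp a) * cis b - 1 - h)%C with
      (RtoC (exp a - 1 - a)
       + ((1 + RtoC (exp a - 1)) * (cis b - 1 - RtoC b * (Ci * 1))
          + RtoC (exp a - 1) * RtoC b * Ci))%C.
    2: { rewrite Hh, !RtoC_minus. ring. }
    eapply Rle_trans; [apply Cmod_triangle|].
    eapply Rle_trans; [apply Rplus_le_compat_l, Cmod_triangle|].
    rewrite !Cmod_mult, Cmod_Ci, !(Cmod_R (exp a - 1)), (Cmod_R b), Rmult_1_r.
    pose proof (Cmod_triangle 1 (RtoC (exp a - 1))) as T. rewrite Cmod_1, Cmod_R in T.
    pose proof (Cmod_ge_0 h) as Hh0. pose proof (Rabs_pos b). pose proof (Rabs_pos (exp a - 1)).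
    assert (W1 : Cmod (1 + RtoC (exp a - 1)) * Cmod (cis b - 1 - RtoC b * (Ci * 1)) <= 2 * (eps * Cmod h) + Rabs (exp a - 1) * (eps * Cmod h) - eps * Cmod h).
    { apply Rle_trans with ((1 + Rabs (exp a - 1)) * (eps * Cmod h)); [|lra].
      apply Rmult_le_compat; auto using Cmod_ge_0. }
    assert (W2 : Rabs (exp a - 1) * Rabs b <= 2 * Cmod h * eps).
    { apply Rmult_le_compat; lra. }
    assert (W3 : Rabs (exp a - 1) * (eps * Cmod h) <= 2 * (eps * Cmod h)).
    { apply Rmult_le_compat_r; [|lra]. apply Rmult_le_pos; lra. }
    assert (W4 : 0 <= eps * Cmod h) by (apply Rmult_le_pos; lra).
    lra. }
  pose proof (Cmod_ge_0 h).
  apply Rle_trans with (Cmod (Cexp w) * (6 * eps * Cmod h)).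
  - apply Rmult_le_compat_l; [exact HE | exact Hcore].
  - replace (Cmod (Cexp w) * (6 * eps * Cmod h)) with (eps * (6 * Cmod (Cexp w)) * Cmod h) by ring.
    apply Rmult_le_compat_r; assumption.
Qed.

(** Principal logarithm, with the argument written through [atan] so that its
    continuity on the right half-plane is immediate. *)
Definition right_log (a : C) : C := (ln (Cmod a), atan (Im a / Re a)).

Lemma Cexp_right_log (a : C) : 0 < Re a -> Cexp (right_log a) = a.
Proof.
  intros Ha. unfold Cexp, right_log. simpl Re. simpl Im.
  assert (Hm : 0 < Cmod a).
  { eapply Rlt_le_trans; [|apply re_le_Cmod]. rewrite Rabs_pos_eq; lra. }
  rewrite exp_ln, cos_atan, sin_atan by exact Hm.
  assert (Hs : sqrt (1 + (Im a / Re a)²) = Cmod a / Re a).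
  { rewrite <- (sqrt_Rsqr (Cmod a / Re a)).
    - f_equal. replace ((Cmod a / Re a)²) with (Cmod a ^ 2 / Re a ^ 2) by (unfold Rsqr; field; lra).
      rewrite Cmod2_alt. unfold Rsqr. field. lra.
    - apply Rlt_le, Rdiv_lt_0_compat; lra. }
  rewrite Hs. destruct a as [x y]. unfold Re, Im in *. simpl in *.
  unfold Cmult, RtoC. simpl. f_equal; field; lra.
Qed.

Lemma right_log_continuous (a : C) : 0 < Re a -> forall eps, 0 < eps ->
  exists delta, 0 < delta /\ forall b, Cmod (b - a) < delta -> Cmod (right_log b - right_log a) < eps.
Proof.
  intros Ha eps Heps.
  assert (Hm : 0 < Cmod a).
  { eapply Rlt_le_trans; [|apply re_le_Cmod]. rewrite Rabs_pos_eq; lra. }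
  assert (C1 : continuous (T := C_UniformSpace) (U := R_UniformSpace) (fun b => ln (Cmod b)) a).
  { apply (continuous_comp (U := C_UniformSpace) (V := R_UniformSpace) (W := R_UniformSpace) Cmod ln).
    - exact (filterlim_norm (K := C_AbsRing) (V := C_NormedModule) a).
    - apply (ex_derive_continuous ln). eexists. apply is_derive_ln. exact Hm. }
  assert (C2 : continuous (T := C_UniformSpace) (U := R_UniformSpace) (fun b => atan (Im b / Re b)) a).
  { apply (continuous_comp (U := C_UniformSpace) (V := R_UniformSpace) (W := R_UniformSpace) (fun b => Im b / Re b) atan).
    - apply (continuous_mult (U := C_UniformSpace) (K := R_AbsRing) (fun b : C => Im b) (fun b : C => / Re b)).
      + destruct a. apply continuous_snd.
      + apply (continuous_comp (U := C_UniformSpace) (V := R_UniformSpace) (W := R_UniformSpace) Re Rinv).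
        * destruct a. apply continuous_fst.
        * apply (ex_derive_continuous Rinv). eexists. apply (is_derive_inv (fun x => x)); [apply is_derive_id | lra].
    - apply continuous_atan. }
  destruct (C_continuous_eps _ _ C1 (eps / 2)) as [d1 [P1 H1]]; [lra|].
  destruct (C_continuous_eps _ _ C2 (eps / 2)) as [d2 [P2 H2]]; [lra|].
  exists (Rmin d1 d2). split; [now apply Rmin_pos|]. intros b Hb.
  specialize (H1 b (Rlt_le_trans _ _ _ Hb (Rmin_l _ _))).
  specialize (H2 b (Rlt_le_trans _ _ _ Hb (Rmin_r _ _))).
  eapply Rle_lt_trans; [apply Cmod_le_Rabs|]. simpl. unfold Rminus in *. lra.
Qed.

(** A continuous right inverse of a function with nonzero derivative is
    differentiable. *)
Lemma inverse_derive (E L : C -> C) (a e : C) :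
  e <> 0%C -> is_Cderive E (L a) e ->
  (exists delta, 0 < delta /\ forall b, Cmod (b - a) < delta -> E (L b) = b) ->
  (forall eps, 0 < eps -> exists delta, 0 < delta /\
     forall b, Cmod (b - a) < delta -> Cmod (L b - L a) < eps) ->
  is_Cderive L a (/ e)%C.
Proof.
  intros He HE [d0 [P0 Hinv]] Hcont. apply C_derive_eps. intros eps Heps.
  set (m := Cmod e). assert (Hm : 0 < m) by now apply Cmod_gt_0.
  (* [m / 2] gives [|D| <= 2 |h| / m]; the second bound then yields the claim. *)
  set (eta := Rmin (m / 2) (eps * m ^ 2 / 2)).
  assert (Hmm : 0 < m ^ 2) by now apply pow_lt.
  assert (Heta : 0 < eta) by (apply Rmin_pos; nra).
  assert (Heta1 : eta <= m / 2) by apply Rmin_l.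
  assert (Heta2 : eta <= eps * m ^ 2 / 2) by apply Rmin_r.
  destruct (proj1 (C_derive_eps E (L a) e) HE eta Heta) as [d1 [P1 H1]].
  destruct (Hcont d1 P1) as [d2 [P2 H2]].
  exists (Rmin d0 d2). split; [now apply Rmin_pos|]. intros b Hb.
  assert (Ea : E (L a) = a).
  { apply Hinv. unfold Cminus. rewrite Cplus_opp_r, Cmod_0. exact P0. }
  specialize (H1 (L b) (H2 b (Rlt_le_trans _ _ _ Hb (Rmin_r _ _)))).
  rewrite Ea, (Hinv b (Rlt_le_trans _ _ _ Hb (Rmin_l _ _))) in H1.
  set (D := (L b - L a)%C) in *. set (h := (b - a)%C) in *.
  pose proof (Cmod_ge_0 D) as HD. pose proof (Cmod_ge_0 h) as Hh.
  assert (HDm : Cmod D * m <= 2 * Cmod h).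
  { pose proof (Cmod_minus_triangle h (h - D * e)) as T.
    replace (h - (h - D * e))%C with (D * e)%C in T by ring.
    rewrite Cmod_mult in T. fold m in T. nra. }
  replace (D - h * / e)%C with (- ((h - D * e) * / e))%C by (field; exact He).
  rewrite Cmod_opp, Cmod_mult, Cmod_inv by exact He. fold m.
  apply (Rmult_le_reg_r m); [exact Hm|]. rewrite Rmult_assoc, Rinv_l, Rmult_1_r by lra.
  eapply Rle_trans; [exact H1|].
  apply Rle_trans with (eps * m ^ 2 / 2 * Cmod D); [apply Rmult_le_compat_r; assumption|].
  replace (eps * m ^ 2 / 2 * Cmod D) with (eps * m / 2 * (Cmod D * m)) by field.
  replace (eps * Cmod h * m) with (eps * m / 2 * (2 * Cmod h)) by field.
  apply Rmult_le_compat_l; [nra | exact HDm].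
Qed.

Lemma right_log_derive (a : C) : 0 < Re a -> is_Cderive right_log a (/ a)%C.
Proof.
  intros Ha. apply (inverse_derive Cexp).
  - intros E. rewrite E in Ha. simpl in Ha. lra.
  - rewrite <- (Cexp_right_log a Ha) at 2. apply Cexp_derive.
  - exists (Re a). split; [exact Ha|]. intros b Hb. apply Cexp_right_log.
    destruct (Rabs_Re_Im_le (b - a)) as [R1 _].
    replace (Re (b - a)) with (Re b - Re a) in R1 by reflexivity.
    assert (Rabs (Re b - Re a) < Re a) as A by lra. apply Rabs_def2 in A. lra.
  - now apply right_log_continuous.
Qed.

Lemma Rabs_atan_le (x : R) : Rabs (atan x) <= Rabs x.
Proof.
  destruct (MVT_gen atan 0 x (fun t => / (1 + t²))) as [c [_ Hc]].
  - intros t _. apply is_derive_atan.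
  - intros t _. apply continuity_pt_filterlim. apply continuous_atan.
  - rewrite atan_0, !Rminus_0_r in Hc. rewrite Hc, Rabs_mult.
    assert (Hc1 : 0 < / (1 + c²) <= 1).
    { pose proof (Rle_0_sqr c). split; [apply Rinv_0_lt_compat; lra|].
      rewrite <- Rinv_1. apply Rinv_le_contravar; lra. }
    rewrite (Rabs_pos_eq (/ _)) by lra. pose proof (Rabs_pos x). nra.
Qed.

(** If [u = |q - 1|], both [|ln |q||] and [|Im q / Re q|] are at most [u / (1 - u)].
    The constant 0.41 is just below the solution of [sqrt 2 u = 1 - u]. *)
Lemma right_log_bound (q : C) (t : R) : 0 <= t <= 1 -> Cmod (q - 1) <= 41 / 100 * t ->
  0 < Re q /\ Cmod (right_log q) <= t.
Proof.
  intros Ht Hq. set (u := Cmod (q - 1)) in *.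
  destruct (Rabs_Re_Im_le (q - 1)) as [R1 R2]. fold u in R1, R2.
  replace (Re (q - 1)) with (Re q - 1) in R1 by reflexivity.
  replace (Im (q - 1)) with (Im q) in R2 by (unfold Im; destruct q; simpl; ring).
  pose proof (Cmod_ge_0 (q - 1)) as Hu0. fold u in Hu0.
  assert (Hre : 1 - u <= Re q) by (apply Rabs_le_between in R1; lra).
  split; [lra|].
  assert (Hm1 : 1 - u <= Cmod q).
  { pose proof (re_le_Cmod q) as T. rewrite Rabs_pos_eq in T; lra. }
  assert (Hm2 : Cmod q <= 1 + u).
  { replace q with ((q - 1) + 1)%C by ring. eapply Rle_trans; [apply Cmod_triangle|].
    rewrite Cmod_1. fold u. lra. }
  set (K := u / (1 - u)).
  assert (EK : 1 + K = / (1 - u)) by (unfold K; field; lra).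
  assert (HKu : u <= K).
  { unfold K. apply Rle_div_r; nra. }
  assert (HKt : K <= 7 / 10 * t).
  { unfold K. apply Rle_div_l; nra. }
  unfold right_log. apply Cmod_le_squares; [lra|].
  assert (L1 : Rabs (ln (Cmod q)) <= K).
  { apply Rabs_ln_le; [lra|lra|]. rewrite EK. apply Rinv_le_contravar; lra. }
  assert (L2 : Rabs (atan (Im q / Re q)) <= K).
  { eapply Rle_trans; [apply Rabs_atan_le|]. rewrite Rabs_div, (Rabs_pos_eq (Re q)) by lra.
    unfold K. unfold Rdiv. apply Rmult_le_compat; [apply Rabs_pos| |exact R2|].
    - left. apply Rinv_0_lt_compat. lra.
    - apply Rinv_le_contravar; lra. }
  rewrite <- (pow2_abs (ln _)), <- (pow2_abs (atan _)).
  pose proof (Rabs_pos (ln (Cmod q))). pose proof (Rabs_pos (atan (Im q / Re q))).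
  assert (K ^ 2 <= (7 / 10 * t) ^ 2) by (apply pow_incr; lra).
  assert (Rabs (ln (Cmod q)) ^ 2 <= K ^ 2) by (apply pow_incr; lra).
  assert (Rabs (atan (Im q / Re q)) ^ 2 <= K ^ 2) by (apply pow_incr; lra).
  nra.
Qed.

(** * The subordination *)

Lemma exp_1_lower : 27 / 10 <= exp 1.
Proof.
  pose proof (exp_ge_taylor 1 4 ltac:(lra)) as H. simpl in H. lra.
Qed.

(** With [e >= 2.7] and [PI >= 3], [e (e + 1) + PI e / 2] exceeds 14. *)
Lemma gamma1_lower (m k g1 g2 g3 : R) :
  2 <= m -> m <= k -> 0 < g1 -> 0 < g2 -> 0 < g3 ->
  2 * (g1 - g2 - m ^ 2 * g3 - 3 * m * (k - 1) * g3 - exp 1 * (exp 1 + 1)) >= PI * exp 1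
  \/ 2 * (1 - exp 1 - exp 1 * (g1 + g2 + m ^ 2 * g3 + 3 * m * (k - 1) * g3)) >= PI ->
  14 <= g1.
Proof.
  intros Hm Hk H1 H2 H3 Hcond.
  pose proof exp_1_lower as He. pose proof PI2_3_2 as HPI.
  assert (A1 : 0 <= m ^ 2 * g3) by (apply Rmult_le_pos; [apply pow2_ge_0 | lra]).
  assert (A2 : 0 <= 3 * m * (k - 1) * g3) by (repeat apply Rmult_le_pos; lra).
  destruct Hcond as [H|H].
  - assert (B1 : 27 / 10 * (37 / 10) <= exp 1 * (exp 1 + 1)) by (apply Rmult_le_compat; lra).
    assert (B2 : 3 * (27 / 10) <= PI * exp 1) by (apply Rmult_le_compat; lra).
    lra.
  - (* The left side is negative because [1 < e]. *)
    exfalso.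
    assert (0 <= exp 1 * (g1 + g2 + m ^ 2 * g3 + 3 * m * (k - 1) * g3)) by (apply Rmult_le_pos; lra).
    lra.
Qed.

Theorem theorem4p4 (m k gamma1 gamma2 gamma3 : R) (p : C -> C)
  (hm : 2 <= m) (hmk : m <= k)
  (hg1 : 0 < gamma1) (hg2 : 0 < gamma2) (hg3 : 0 < gamma3)
  (hcond :
    2 * (gamma1 - gamma2 - m ^ 2 * gamma3 - 3 * m * (k - 1) * gamma3
         - exp 1 * (exp 1 + 1)) >= PI * exp 1
    \/
    2 * (1 - exp 1
         - exp 1 * (gamma1 + gamma2 + m ^ 2 * gamma3
                    + 3 * m * (k - 1) * gamma3)) >= PI)
  (hp : analytic_on_disk p)
  (hp0 : p (RtoC 0) = RtoC 1)
  (hsub : subordinate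
    (fun z : C =>
       p z
       + RtoC gamma1 * z * C_derive p z
       + RtoC gamma2 * z ^ 2 * C_derive (C_derive p) z
       + RtoC gamma3 * z ^ 3 * C_derive (C_derive (C_derive p)) z)%C
    (fun z : C => (1 + Carcsinh z)%C)) :
  subordinate p Cexp.
Proof.
  pose proof (gamma1_lower _ _ _ _ _ hm hmk hg1 hg2 hg3 hcond) as Hg1.
  destruct hsub as [w [_ [Hw [_ [_ Heq]]]]].
  assert (Hbound : forall z, in_disk z -> Cmod (p z + RtoC gamma1 * z * C_derive p z
     + RtoC gamma2 * z ^ 2 * C_derive (C_derive p) z
     + RtoC gamma3 * z ^ 3 * C_derive (C_derive (C_derive p)) z - 1)%C <= 36 / 10).
  { intros z Hz. rewrite (Heq z Hz).
    replace (1 + Carcsinh (w z) - 1)%C with (Carcsinh (w z)) by ring.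
    apply Carcsinh_bound, Hw, Hz. }
  assert (Hclose : forall z, in_disk z -> Cmod (p z - 1)%C <= 41 / 100 * Cmod z).
  { intros z Hz. unfold in_disk in Hz.
    (* The loss [1 / rho] must stay below 0.41 * 14 / 5.4; hence the threshold 0.96. *)
    set (rho := Rmax (Cmod z) (96 / 100)). set (r := (1 + rho) / 2).
    assert (Hrho : 96 / 100 <= rho < 1).
    { split; [apply Rmax_r | apply Rmax_lub_lt; lra]. }
    pose proof (deviation_bound gamma1 gamma2 gamma3 r rho (36 / 10) p (taylor_coef p r)) as D.
    eapply Rle_trans; [apply D; try lra|].
    - unfold r; lra.
    - intros y Hy. apply taylor_expansion; auto. unfold r; lra.
    - exact hp0.
    - intros y Hy. apply Hbound. unfold in_disk. unfold r in Hy. lra.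
    - apply Rmax_l.
    - pose proof (Cmod_ge_0 z) as Hz0.
      assert (A : / gamma1 <= / 14) by (apply Rinv_le_contravar; lra).
      assert (B : / rho <= / (96 / 100)) by (apply Rinv_le_contravar; lra).
      assert (A0 : 0 < / gamma1) by (apply Rinv_0_lt_compat; lra).
      assert (B0 : 0 < / rho) by (apply Rinv_0_lt_compat; lra).
      replace (3 * (36 / 10) / (2 * gamma1) * (Cmod z / rho)) with
        (54 / 10 * (/ gamma1 * / rho) * Cmod z) by (field; lra).
      apply Rmult_le_compat_r; [exact Hz0|].
      assert (/ gamma1 * / rho <= / 14 * / (96 / 100)) by (apply Rmult_le_compat; lra).
      lra. }
  assert (Hlog : forall z, in_disk z -> 0 < Re (p z) /\ Cmod (right_log (p z)) <= Cmod z).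
  { intros z Hz. apply right_log_bound; [|now apply Hclose].
    unfold in_disk in Hz. pose proof (Cmod_ge_0 z). lra. }
  exists (fun z => right_log (p z)). repeat split.
  - intros z Hz. destruct (hp z Hz) as [l Hl]. eexists.
    apply (is_derive_comp (K := C_AbsRing) (V := C_NormedModule) right_log p z).
    + apply right_log_derive. now apply Hlog.
    + destruct Hl as [_ Hl]. split; [apply (is_linear_scal_l (V := AbsRing_NormedModule C_AbsRing)) | exact Hl].
  - intros z Hz. unfold in_disk in *. eapply Rle_lt_trans; [now apply Hlog | exact Hz].
  - apply Cmod_eq_0. apply Rle_antisym; [|apply Cmod_ge_0].
    assert (H0 : in_disk (RtoC 0)) by (unfold in_disk; rewrite Cmod_0; lra).
    pose proof (proj2 (Hlog _ H0)) as T. rewrite Cmod_0 in T. exact T.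
  - intros z Hz. now apply Hlog.
  - intros z Hz. symmetry. apply Cexp_right_log. now apply Hlog.
Qed.
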